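(* Let $m$ be a positive integer, let $(K,\partial_0,\dots,\partial_{m-1})$ be a field with $m$ commuting derivations, and let $r$ and $n$ be positive integers. Then there is a positive integer $s\ge r$ such that: if a field extension $K(a_h^{\xi}\colon|\xi|\le s\land h<n)$ of $K$ meets the differential condition, then $(K,\partial_0,\dots,\partial_{m-1})$ has an extension $(M,D_0,\dots,D_{m-1})$ (a field $M\supseteq K$ with $m$ commuting derivations extending the $\partial_i$) compatible with $K(a_h^{\xi}\colon|\xi|\le r\land h<n)$, i.e. $K(a_h^{\xi}\colon|\xi|\le r\land h<n)\subseteq M$ and $D_ia_k^{\sigma}=a_k^{\sigma+\varepsilon_i}$ whenever $i<m$, $k<n$ and $|\sigma|+1\le r$.
   Context: $n$ denotes also $\{0,\dots,n-1\}$. For $\sigma\in\mathbb{N}^m$, $|\sigma|=\sum_{i<m}\sigma(i)$; $\varepsilon_i$ is the characteristic function of $\{i\}$ in $\mathbb{N}^m$. The total order $\unlhd$ on $\mathbb{N}^m\times n$: $(\xi,k)\unlhd(\eta,g)$ iff $(|\xi|,k,\xi(0),\dots,\xi(m-2))$ is lexicographically $\le(|\eta|,g,\eta(0),\dots,\eta(m-2))$. The extension $K(a_h^{\xi}\colon|\xi|\le s\land h<n)$ meets the differential condition if: whenever $i<m$, $k<n$, $|\sigma|+1\le s$, and $f$ is a polynomial over $K$ in variables $(x_h^{\xi}\colon(\xi,h)\unlhd(\sigma,k))$ vanishing at $a=(a_h^{\xi}\colon(\xi,h)\unlhd(\sigma,k))$, then $\sum_{(\eta,g)\unlhd(\sigma,k)}\frac{\partial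 f}{\partial x_g^{\eta}}(a)\,a_g^{\eta+\varepsilon_i}+f^{\partial_i}(a)=0$, with $f^{\partial_i}$ being $f$ with $\partial_i$ applied to its coefficients. *)

(* Defs.v *)
From HB Require Import structures.
From mathcomp Require Import all_boot all_order all_algebra.
From mathcomp Require Import mpoly.
Set Implicit Arguments. Unset Strict Implicit. Unset Printing Implicit Defensive.
Import Order.TTheory GRing.Theory.
Local Open Scope ring_scope.

Definition is_derivation (R : ringType) (d : R -> R) : Prop :=
  (forall x y : R, d (x + y) = d x + d y) /\
  (forall x y : R, d (x * y) = d x * y + x * d y).

Definition commuting_derivations (m : nat) (R : ringType) (d : 'I_m -> R -> R) : Prop :=
  (forall i, is_derivation (d i)) /\
  (forall (i j : 'I_m) (x : R), d i (d j x) = d j (d i x)).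

Notation mindex m := {ffun 'I_m -> nat}.

Definition mabs (m : nat) (xi : mindex m) : nat := (\sum_(i < m) xi i)%N.

Definition madd_eps (m : nat) (xi : mindex m) (i : 'I_m) : mindex m :=
  [ffun j => (xi j + (j == i))%N].

Fixpoint lexle (s t : seq nat) : bool :=
  match s, t with
  | [::], _ => true
  | _ :: _, [::] => false
  | x :: s', y :: t' => (x < y)%N || ((x == y) && lexle s' t')
  end.

Definition tri_key (m : nat) (xi : mindex m) (k : nat) : seq nat :=
  mabs xi :: k :: take m.-1 [seq xi i | i <- enum 'I_m].

Definition tri_le (m : nat) (xi : mindex m) (k : nat) (eta : mindex m) (g : nat) : bool :=
  lexle (tri_key xi k) (tri_key eta g).

Definition vidx (m n s : nat) : finType :=
  {v : ({ffun 'I_m -> 'I_s.+1} * 'I_n)%type | (\sum_(i < m) (v.1 i : nat) <= s)%N}.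

Definition vxi (m n s : nat) (v : vidx m n s) : mindex m := [ffun i => nat_of_ord ((val v).1 i)].
Definition vh (m n s : nat) (v : vidx m n s) : nat := (val v).2.

(* number of variables x_h^xi with |xi| <= s, h < n; variable j stands for
   x_{vh (enum_val j)}^{vxi (enum_val j)} *)
Definition nvars (m n s : nat) : nat := #|vidx m n s|.
Definition var_of (m n s : nat) (j : 'I_(nvars m n s)) : vidx m n s := enum_val j.

Definition evalK (m n s : nat) (K L : fieldType) (iota : {rmorphism K -> L})
  (a : mindex m -> nat -> L) (f : {mpoly K[nvars m n s]}) : L :=
  mmap iota (fun j => a (vxi (var_of j)) (vh (var_of j))) f.

Definition differential_condition (m n s : nat) (K L : fieldType)
  (d : 'I_m -> K -> K) (iota : {rmorphism K -> L}) (a : mindex m -> nat -> L) : Prop :=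
  forall (i : 'I_m) (k : nat) (sigma : mindex m),
    (k < n)%N -> (mabs sigma + 1 <= s)%N ->
    forall f : {mpoly K[nvars m n s]},
      (forall mon, mon \in msupp f -> forall j : 'I_(nvars m n s),
          ~~ tri_le (vxi (var_of j)) (vh (var_of j)) sigma k -> mon j = 0%N) ->
      evalK iota a f = 0 ->
      \sum_(j < nvars m n s | tri_le (vxi (var_of j)) (vh (var_of j)) sigma k)
          evalK iota a (mderiv j f) * a (madd_eps (vxi (var_of j)) i) (vh (var_of j))
      + evalK iota a (map_mpoly (d i) f) = 0.

Definition in_gen_field (m n r : nat) (K L : fieldType) (iota : {rmorphism K -> L})
  (a : mindex m -> nat -> L) (x : L) : Prop :=
  exists p q : {mpoly K[nvars m n r]},
    evalK iota a q != 0 /\ x = evalK iota a p / evalK iota a q.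

Definition gen_field_embedding (m n r : nat) (K L M : fieldType)
  (iota : {rmorphism K -> L}) (phi : {rmorphism K -> M})
  (a : mindex m -> nat -> L) (f : L -> M) : Prop :=
  (forall c : K, f (iota c) = phi c) /\
  (forall x y, in_gen_field n r iota a x -> in_gen_field n r iota a y ->
     f (x + y) = f x + f y /\ f (x * y) = f x * f y).

(* Main.v *)
(** The proof follows the leaders of [K(a_h^xi)]: the pairs [(xi, h)] such that [a_h^xi] is
    separably algebraic over the [a] with smaller index.  By the differential condition the set of
    leaders of level [<= s] is closed under [xi |-> xi + eps_i].  By Dickson's lemma together with
    Koenig's lemma, [s] can be chosen from [m], [n] and [r] alone so that, for some
    [r' >= r] with [2r' < s], no minimal leader has level in the interval from [r' + 1] to
    [2r' + 1].  Put [t = 2r'], let [F] be the field generated by the [a] of level [<= t], and let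
    [E] be [F] with one transcendental [b_v] for each index [v].  Over [F] the nonleaders of level
    [t + 1] are linearly independent together with [1], so they may be replaced by the [b_v]: this
    gives derivations from [F] to [E], even in positive characteristic, where the nonleaders of
    level [t] may be inseparable over their predecessors.  Beyond level [t + 1], nonleaders are
    sent to the [b_v] and the value at a leader [v + eps_j], [v] a leader, is forced to be the
    [j]-th derivative of the value at [v].  This does not depend on [j]: two minimal leaders have a
    common multiple of level [<= 2r'], so any two such choices are linked through a third one, and
    for neighbouring choices the commutator of two derivations is a derivation that vanishes on the
    predecessors of a leader, hence on the leader. *)
Require Import Defs.
From HB Require Import structures.
From Stdlib Require Import ClassicalEpsilon FunctionalExtensionality.
From mathcomp Require Import all_boot all_order all_algebra.
From mathcomp Require Import finmap ring.
From mathcomp Require monalg.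
From mathcomp Require Import mpoly.
Set Implicit Arguments. Unset Strict Implicit. Unset Printing Implicit Defensive.
Import GRing.Theory.
Local Open Scope ring_scope.

(** * Classical decision and choice *)

Definition asb (P : Prop) : bool :=
  if excluded_middle_informative P then true else false.

Lemma asbP (P : Prop) : reflect P (asb P).
Proof. by rewrite /asb; case: excluded_middle_informative => h; constructor. Qed.

Definition derivation_along (F E : nzRingType) (c : F -> E) (delta : F -> E) : Prop :=
  (forall x y, delta (x + y) = delta x + delta y) /\
  (forall x y, delta (x * y) = delta x * c y + c x * delta y).

Lemma choose_fun (T U : Type) (Q : T -> U -> Prop) :
  (forall x, exists y, Q x y) -> exists f, forall x, Q x (f x).
Proof.
move=> h; exists (fun x => proj1_sig (constructive_indefinite_description _ (h x))) => x.
by case: constructive_indefinite_description.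
Qed.

(** * Derivations of fraction fields and of rational function fields *)

Section QuotientRule.
Variable E : fieldType.
Implicit Types a b u v : E.

Lemma quotient_rule_add a b a' b' u u' v v' : v != 0 -> v' != 0 ->
  ((a * v' + u * b' + (a' * v + u' * b)) * (v * v') - (u * v' + u' * v) * (b * v' + v * b'))
    / (v * v') ^+ 2
  = (a * v - u * b) / v ^+ 2 + (a' * v' - u' * b') / v' ^+ 2.
Proof.
move=> v0 v'0; rewrite addf_div ?expf_neq0 // exprMn; congr (_ / _); ring.
Qed.

Lemma quotient_rule_mul a b a' b' u u' v v' : v != 0 -> v' != 0 ->
  ((a * u' + u * a') * (v * v') - (u * u') * (b * v' + v * b')) / (v * v') ^+ 2
  = (a * v - u * b) / v ^+ 2 * (u' / v') + u / v * ((a' * v' - u' * b') / v' ^+ 2).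
Proof.
move=> v0 v'0; rewrite !mulf_div addf_div ?mulf_neq0 ?expf_neq0 //.
apply/eqP; rewrite eqr_div ?mulf_neq0 ?expf_neq0 ?mulf_neq0 //; apply/eqP; ring.
Qed.

(** With [a], [b] as the derivatives of [u], [v], the last premise is the derivative of
    [u * v' = u' * v]; so the quotient rule gives the same value on equal fractions. *)
Lemma quotient_rule_unique a b a' b' u u' v v' : v != 0 -> v' != 0 ->
  u * v' = u' * v -> a * v' + u * b' = a' * v + u' * b ->
  (a * v - u * b) / v ^+ 2 = (a' * v' - u' * b') / v' ^+ 2.
Proof.
move=> v0 v'0 e1 e2; apply/eqP; rewrite eqr_div ?expf_neq0 //; apply/eqP/subr0_eq.
transitivity (v * v' * ((a * v' + u * b') - (a' * v + u' * b))
  + (u' * v - u * v') * (b * v' + b' * v)); first by ring.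
by rewrite e1 e2 !subrr mulr0 mul0r addr0.
Qed.
End QuotientRule.

Section QuotientDerivation.
Variables (R : comNzRingType) (L : fieldType) (ev : {rmorphism R -> L}) (N : R -> L).
Variable low : R -> Prop.
Hypotheses (low1 : low 1) (lowD : forall p q, low p -> low q -> low (p + q))
  (lowN : forall p, low p -> low (- p)) (lowM : forall p q, low p -> low q -> low (p * q)).
Hypothesis N_der : derivation_along ev N.
Hypothesis N_ker : forall p, low p -> ev p = 0 -> N p = 0.

Definition is_quotient (x : L) : Prop :=
  exists p q, [/\ low p, low q, ev q != 0 & x = ev p / ev q].

(** [N p] is the value that [D (ev p)] must have. As [N] vanishes on the elements of [low] that [ev]
    kills, the quotient rule does not depend on the chosen fraction. This is applied to fraction
    fields and to the field in the differential condition. *)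
Lemma quotient_derivation : exists D : L -> L,
  (forall x y, is_quotient x -> is_quotient y ->
     D (x + y) = D x + D y /\ D (x * y) = D x * y + x * D y) /\
  (forall p, low p -> D (ev p) = N p).
Proof.
have [ND NM] := N_der.
have hD x : exists y, forall p q, low p -> low q -> ev q != 0 -> x = ev p / ev q ->
    y = (N p * ev q - ev p * N q) / ev q ^+ 2.
  have [[p [q [lp lq q0 e]]]|h] := classic (is_quotient x); last first.
    (* Outside the quotients [D] takes the default value 0. *)
    by exists 0 => p q lp lq q0 e; case: h; exists p, q.
  exists ((N p * ev q - ev p * N q) / ev q ^+ 2) => p' q' lp' lq' q'0 e'.
  have e1 : ev p * ev q' = ev p' * ev q by apply/eqP; rewrite -eqr_div // -e -e'.
  apply: quotient_rule_unique => //.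
  have : N (p * q' + - (p' * q)) = 0.
    apply: N_ker; first by apply: lowD; [|apply: lowN]; apply: lowM.
    by rewrite rmorphD rmorphN !rmorphM e1 subrr.
  have N0 : N 0 = 0 by apply: (addrI (N 0)); rewrite -ND !addr0.
  have NN r : N (- r) = - N r by apply: (addrI (N r)); rewrite -ND !subrr N0.
  by rewrite ND NN !NM => /subr0_eq.
have [D hD'] := choose_fun hD; exists D; split=> [x y|p lp].
  move=> [p [q [lp lq q0 e]]] [p' [q' [lp' lq' q'0 e']]].
  have qq0 : ev (q * q') != 0 by rewrite rmorphM mulf_neq0.
  rewrite (hD' _ _ _ lp lq q0 e) (hD' _ _ _ lp' lq' q'0 e').
  have lqq := lowM lq lq'.
  rewrite (hD' _ (p * q' + p' * q) _ _ lqq qq0); last 2 first.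
    by apply: lowD; apply: lowM.
    by rewrite e e' addf_div // rmorphD !rmorphM.
  rewrite (hD' _ _ _ (lowM lp lp') lqq qq0); last by rewrite e e' mulf_div !rmorphM.
  rewrite e e' ND !NM rmorphD !rmorphM; split; first exact: quotient_rule_add.
  exact: quotient_rule_mul.
rewrite (hD' _ p 1) ?rmorph1 ?oner_neq0 ?divr1 //.
have N1 : N 1 = 0.
  by have := NM 1 1; rewrite !mulr1 rmorph1 mulr1 mul1r -{1}(addr0 (N 1)) => /addrI.
by rewrite N1 mulr0 subr0 mulr1 expr1n divr1.
Qed.
End QuotientDerivation.

(** * Polynomials in arbitrarily many variables *)

Module FreePolynomials.
Import monalg mpoly.

Section Domain.
Variables (F : fieldType) (I : choiceType).

Definition restr (s : seq I) (m : {cmonom I}) : 'X_{1.. size s} :=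
  [multinom m (tnth (in_tuple s) j) | j < size s].

Definition restrX (s : seq I) (m : {cmonom I}) : mpoly (size s) F :=
  mpolyX F (restr s m).

Lemma restrX_mmorphism s : mmorphism (restrX s).
Proof.
split=> [x y|]; rewrite /restrX.
  rewrite -mpolyXD; congr (mpolyX _ _); apply/mnmP => j.
  by rewrite mnmDE !mnmE cmM.
rewrite (_ : restr s (@mone _) = 0%MM) ?mpolyX0 //.
by apply/mnmP => j; rewrite mnm0E mnmE cm1.
Qed.

HB.instance Definition _ s :=
  isMultiplicative.Build {cmonom I} (mpoly (size s) F) (restrX s) (restrX_mmorphism s).

Definition to_mpoly (s : seq I) : {malg F[{cmonom I}]} -> mpoly (size s) F :=
  monalg.mmap (@mpolyC (size s) F) (restrX s).

Definition fpoly_vars (p : {malg F[{cmonom I}]}) : seq I :=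
  flatten (map (fun m : {cmonom I} => (finsupp m : seq I)) (monalg.msupp p)).

Lemma restr_inj (s : seq I) (m1 m2 : {cmonom I}) : {subset (finsupp m1 : seq I) <= s} ->
  {subset (finsupp m2 : seq I) <= s} -> restr s m1 = restr s m2 -> m1 = m2.
Proof.
move=> s1 s2 e; apply/eqP/cmP => i.
have [si|si] := boolP (i \in s).
  have /(congr1 (fun m : 'X_{1.. size s} => m (Ordinal (etrans (index_mem i s) si)))) := e.
  by rewrite !mnmE !(tnth_nth i) /= nth_index.
have := contra (s1 i) si; have := contra (s2 i) si.
by rewrite -!cmE_eq0 => /eqP -> /eqP ->.
Qed.

(** Restriction to a list that contains all variables of [p] keeps the monomials of [p] distinct, so
    no coefficient is lost. *)
Lemma to_mpoly_neq0 s p : {subset fpoly_vars p <= s} -> p != 0 -> to_mpoly s p != 0.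
Proof.
move=> sub; rewrite -monalg.msupp_eq0 => /fset0Pn [m mp].
have subm (m' : {cmonom I}) : m' \in monalg.msupp p -> {subset (finsupp m' : seq I) <= s}.
  by move=> m'p i im; apply: sub; apply/flattenP; exists (finsupp m' : seq I) => //; exact: map_f.
apply/eqP => /(congr1 (mcoeff (restr s m))) /eqP.
rewrite mcoeff0 /to_mpoly monalg.mmapE raddf_sum /= (big_fsetD1 m) //= mcoeffCM mcoeffX eqxx mulr1.
rewrite big_seq big1 ?addr0 ?monalg.mcoeff_eq0 ?mp // => m' /fsetD1P [mm' m'p].
rewrite mcoeffCM mcoeffX; case: eqP => [/restr_inj e|]; last by rewrite mulr0.
by rewrite (e (subm _ m'p) (subm _ mp)) eqxx in mm'.
Qed.

(** Both factors together involve finitely many variables, so the product can be tested in a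
    polynomial ring [mpoly], which is a domain. *)
Lemma fpoly_integral (p q : {malg F[{cmonom I}]}) : p * q = 0 -> (p == 0) || (q == 0).
Proof.
move=> pq; apply/norP => -[p0 q0].
pose s := fpoly_vars p ++ fpoly_vars q.
have sp : to_mpoly s p != 0 by apply: to_mpoly_neq0 => // i ip; rewrite mem_cat ip.
have sq : to_mpoly s q != 0 by apply: to_mpoly_neq0 => // i ip; rewrite mem_cat ip orbT.
have : to_mpoly s p * to_mpoly s q != 0 by rewrite mulf_neq0.
by rewrite /to_mpoly -(rmorphM (monalg.mmap _ _)) pq rmorph0 eqxx.
Qed.

Definition fpoly_unit (p : {malg F[{cmonom I}]}) : bool := asb (exists q, q * p = 1).

Definition fpoly_inv (p : {malg F[{cmonom I}]}) : {malg F[{cmonom I}]} :=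
  if excluded_middle_informative (exists q, q * p = 1) is left h
  then proj1_sig (constructive_indefinite_description _ h) else p.

Lemma fpoly_mulVx : {in fpoly_unit, left_inverse 1 fpoly_inv *%R}.
Proof.
move=> p /asbP h; rewrite /fpoly_inv; case: excluded_middle_informative => // h'.
by case: constructive_indefinite_description.
Qed.

Lemma fpoly_unitPl p q : q * p = 1 -> fpoly_unit p.
Proof. by move=> h; apply/asbP; exists q. Qed.

Lemma fpoly_invr_out : {in [predC fpoly_unit], fpoly_inv =1 id}.
Proof.
move=> p; rewrite !inE /fpoly_inv /fpoly_unit /in_mem /= /asb.
by case: excluded_middle_informative.
Qed.

HB.instance Definition _ := GRing.ComNzRing_hasMulInverse.Build {malg F[{cmonom I}]}
  fpoly_mulVx fpoly_unitPl fpoly_invr_out.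
HB.instance Definition _ := GRing.ComUnitRing_isIntegral.Build {malg F[{cmonom I}]}
  fpoly_integral.
End Domain.

(** The premises are conditional because dividing a monomial by [v] truncates: the result is a true
    quotient only if the exponent of [v] is nonzero, and otherwise the multiplicity removes the
    term. *)
Lemma leibniz_term (E : fieldType) (x x1 x2 y1 y2 b : E) (k1 k2 : nat) :
  (k1 != 0%N -> x = x1 * y2) -> (k2 != 0%N -> x = x2 * y1) ->
  x * b *+ (k1 + k2) = x1 * b *+ k1 * y2 + y1 * (x2 * b *+ k2).
Proof.
move=> h1 h2; rewrite mulrnDr; congr (_ + _).
  have [->|h] := eqVneq k1 0%N; first by rewrite !mulr0n mul0r.
  by rewrite h1 // mulrnAl; congr (_ *+ _); ring.
have [->|h] := eqVneq k2 0%N; first by rewrite !mulr0n mulr0.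
by rewrite h2 // mulrnAr; congr (_ *+ _); ring.
Qed.

(* Here and below, ring computations are carried out for variables instead of monomials:
   comparing two terms of [malg] unfolds their finite-support representation, which is slow. *)
Section Leibniz.
Variables (R : comNzRingType) (E : fieldType) (e : {rmorphism R -> E}) (D : R -> E).
Hypothesis DD : forall p q, D (p + q) = D p + D q.

Definition leibniz p q := D (p * q) = D p * e q + e p * D q.

Lemma der0 : D 0 = 0.
Proof. by apply: (addrI (D 0)); rewrite -DD !addr0. Qed.

Lemma leibniz0l q : leibniz 0 q.
Proof. by rewrite /leibniz mul0r rmorph0 der0 !mul0r addr0. Qed.

Lemma leibniz0r p : leibniz p 0.
Proof. by rewrite /leibniz mulr0 rmorph0 der0 !mulr0 addr0. Qed.

Lemma leibnizDl p1 p2 q : leibniz p1 q -> leibniz p2 q -> leibniz (p1 + p2) q.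
Proof.
by rewrite /leibniz => h1 h2; rewrite mulrDl !DD h1 h2 rmorphD !mulrDl addrACA.
Qed.

Lemma leibnizDr p q1 q2 : leibniz p q1 -> leibniz p q2 -> leibniz p (q1 + q2).
Proof.
by rewrite /leibniz => h1 h2; rewrite mulrDr !DD h1 h2 rmorphD !mulrDr addrACA.
Qed.
End Leibniz.

Section Derivation.
Variables (F : fieldType) (I : choiceType).
Notation A := {malg F[{cmonom I}]}.

Lemma fpoly_ind (P : A -> Prop) : P 0 -> (forall x m, P << x *g m >>) ->
  (forall p q, P p -> P q -> P (p + q)) -> forall p, P p.
Proof.
move=> P0 PU PD p; rewrite [p]monalgE.
by elim/big_ind: _.
Qed.

Variables (E : fieldType) (e : {rmorphism A -> E}).
Variables (delta : {additive F -> E}) (beta : I -> E).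
Let c (x : F) : E := e << x *g mone >>.
Hypothesis deltaM : forall x y, delta (x * y) = delta x * c y + c x * delta y.

Definition mono (m : {cmonom I}) : E := e << 1 *g m >>.

Definition dmono (m : {cmonom I}) : E :=
  \sum_(v <- (finsupp m : seq I)) mono (divcm m (ucm v)) * beta v *+ m v.

Lemma dmonoEw (m : {cmonom I}) (s : {fset I}) : (finsupp m `<=` s)%fset ->
  dmono m = \sum_(v <- s) mono (divcm m (ucm v)) * beta v *+ m v.
Proof.
move=> sub; rewrite /dmono (big_fset_incl _ sub) //= => v vs.
by rewrite -cmE_eq0 => /eqP ->; rewrite mulr0n.
Qed.

Lemma monoM m1 m2 : mono (mmul m1 m2) = mono m1 * mono m2.
Proof. by rewrite /mono -rmorphM malgM_def fgmulUU mulr1. Qed.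

Lemma monoU_div (m1 m2 : {cmonom I}) v : m1 v != 0%N ->
  mono (divcm (mmul m1 m2) (ucm v)) = mono (divcm m1 (ucm v)) * mono m2.
Proof.
move=> h; rewrite -monoM; congr mono; apply/eqP/cmP => i.
rewrite divcmE !cmM divcmE ucmE.
have [<-|_] := eqVneq v i; last by rewrite !subn0.
by rewrite addnC -addnBA ?lt0n // addnC.
Qed.

Lemma dmonoM m1 m2 : dmono (mmul m1 m2) = dmono m1 * mono m2 + mono m1 * dmono m2.
Proof.
pose s := (finsupp m1 `|` finsupp m2)%fset.
rewrite (@dmonoEw _ s) ?mdomD // (@dmonoEw m1 s) ?fsubsetUl // (@dmonoEw m2 s) ?fsubsetUr //.
rewrite [X in _ = X + _]mulr_suml [X in _ = _ + X]mulr_sumr -big_split /=; apply: eq_bigr => v _.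
rewrite (cmM v m1 m2); apply: leibniz_term => h; first exact: monoU_div.
by rewrite mulmC monoU_div.
Qed.

Lemma e_monomial x m : e << x *g m >> = c x * mono m.
Proof. by rewrite /c /mono -rmorphM malgM_def fgmulUU mulr1 mul1m. Qed.

Lemma c_is_additive : zmod_morphism c.
Proof. by move=> x y; rewrite /c monalgUB rmorphB. Qed.

HB.instance Definition _ := GRing.isZmodMorphism.Build F E c c_is_additive.

(** The first summand differentiates the coefficients by [delta], the second the monomials, with
    [beta v] as the derivative of the variable [v]. *)
Definition poly_der (p : A) : E := monalg.mmap delta mono p + monalg.mmap c dmono p.

Lemma poly_derD p q : poly_der (p + q) = poly_der p + poly_der q.
Proof. by rewrite /poly_der !(monalg.mmapD p q) addrACA. Qed.

Lemma poly_derU x m : poly_der << x *g m >> = delta x * mono m + c x * dmono m.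
Proof. by rewrite /poly_der !monalg.mmapU. Qed.

Lemma cM x y : c (x * y) = c x * c y.
Proof. by rewrite /c -rmorphM malgM_def fgmulUU mul1m. Qed.

Lemma poly_derM_mono x y m1 m2 (X Y Z : A) :
  poly_der X = delta x * mono m1 + c x * dmono m1 ->
  poly_der Y = delta y * mono m2 + c y * dmono m2 ->
  poly_der Z = delta (x * y) * mono (mmul m1 m2) + c (x * y) * dmono (mmul m1 m2) ->
  e X = c x * mono m1 -> e Y = c y * mono m2 ->
  poly_der Z = poly_der X * e Y + e X * poly_der Y.
Proof.
move=> -> -> -> -> ->; rewrite deltaM dmonoM monoM cM.
move: (c x) (c y) (delta x) (delta y) (mono m1) (mono m2) (dmono m1) (dmono m2) => *; ring.
Qed.

Lemma poly_derM p q : leibniz e poly_der p q.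
Proof.
elim/fpoly_ind: p => [|x m1|]; first exact: (leibniz0l e poly_derD); last first.
  by move=> *; apply: (leibnizDl poly_derD).
elim/fpoly_ind: q => [|y m2|]; first exact: (leibniz0r e poly_derD); last first.
  by move=> *; apply: (leibnizDr poly_derD).
rewrite /leibniz.
have -> : << x *g m1 >> * << y *g m2 >> = << x * y *g mmul m1 m2 >> :> A by exact/fgmulUU.
exact: (poly_derM_mono (poly_derU x m1) (poly_derU y m2) (poly_derU _ _)
          (e_monomial x m1) (e_monomial y m2)).
Qed.

Lemma mono1 : mono mone = 1.
Proof. by rewrite /mono -(rmorph1 e). Qed.

Lemma dmono1 : dmono mone = 0.
Proof. by rewrite /dmono mdom1 big_seq_fset0. Qed.

Lemma dmonoU v : dmono (ucm v) = beta v.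
Proof.
rewrite /dmono mdomU big_seq_fset1 cmUU mulr1n.
have -> : divcm (ucm v) (ucm v) = mone :> {cmonom I}.
  by apply/eqP/cmP => i; rewrite divcmE subnn cm1.
by rewrite mono1 mul1r.
Qed.

Lemma poly_derC x : poly_der << x *g mone >> = delta x.
Proof. by rewrite poly_derU mono1 dmono1 mulr0 addr0 mulr1. Qed.

Lemma poly_derX v : poly_der << 1 *g ucm v >> = beta v.
Proof.
have d1 : delta 1 = 0.
  have := deltaM 1 1; rewrite mulr1 (_ : c 1 = 1); last exact: mono1.
  by rewrite mulr1 mul1r -{1}(addr0 (delta 1)) => /addrI.
by rewrite poly_derU dmonoU d1 mul0r add0r (_ : c 1 = 1) ?mul1r //; exact: mono1.
Qed.
End Derivation.

Lemma cmonom_ind (I : choiceType) (P : {cmonom I} -> Prop) : P mone ->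
  (forall v m, P m -> P (mmul (ucm v) m)) -> forall m, P m.
Proof.
move=> P1 PS m; move: {2}(monalg.mdeg m) (leqnn (monalg.mdeg m)) => k.
elim: k m => [|k IH] m; first by rewrite leqn0 => /eqP /monalg.mdeg_eq0I ->.
have [/eqP ->//|m1 hm] := boolP (m == mone).
have [v hv] : exists v, m v != 0%N.
  have /fset0Pn [v vm] : (finsupp m != fset0)%fset.
    apply: contra m1 => /eqP h; apply/cmP => i; rewrite cm1; apply/eqP.
    by rewrite cmE_eq0 h in_fset0.
  by exists v; rewrite cmE_neq0.
have e : m = mmul (ucm v) (divcm m (ucm v)).
  apply/eqP/cmP => i; rewrite cmM divcmE ucmE.
  by have [<-|_] := eqVneq v i; rewrite ?add0n ?subn0 // subnKC // lt0n.
rewrite e; apply: PS; apply: IH; move: hm; rewrite {1}e monalg.mdegM monalg.mdegU.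
by rewrite add1n ltnS.
Qed.

Section Fractions.
Variable R : idomainType.
Local Notation "x %:F" := (FracField.tofrac x).

Lemma fraction_numden (x : {fraction R}) :
  x = (frac (repr x)).1%:F / (frac (repr x)).2%:F.
Proof.
have dn0 := denom_ratioP (repr x).
apply: (canRL (mulfK _)); first by rewrite tofrac_eq0.
rewrite -{1}[x]reprK; move: (repr x) dn0 => y dn0.
have := FracField.Ratio_numden y; move: dn0; case: (frac y) => n d /= dn0 <-.
change (FracField.mul (\pi_(FracField.type R) (Ratio n d))%qT d%:F = n%:F).
rewrite !piE; apply/eqmodP; rewrite /= FracField.equivfE.
by rewrite /FracField.mulf !numden_Ratio ?mulf_neq0 ?oner_neq0 //= ?mulr1 // mulrC.
Qed.

Lemma fraction_derivation (N : R -> {fraction R}) :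
  derivation_along (@FracField.tofrac R) N ->
  exists D : {fraction R} -> {fraction R}, is_derivation D /\ forall p, D p%:F = N p.
Proof.
move=> N_der; have Q x : is_quotient (@FracField.tofrac R) (fun=> True) x.
  exists (frac (repr x)).1, (frac (repr x)).2; split=> //.
    by rewrite tofrac_eq0 denom_ratioP.
  exact: fraction_numden.
have [||||p _ /eqP|D [DD DE]] := quotient_derivation _ _ _ _ N_der (low := fun=> True) => //.
  rewrite tofrac_eq0 => /eqP ->; have [ND _] := N_der.
  by apply: (addrI (N 0)); rewrite -ND !addr0.
exists D; split=> [|p]; last exact: DE.
by split=> x y; case: (DD x y (Q x) (Q y)).
Qed.
End Fractions.

Section KillFraction.
Variables (R : idomainType) (D : {fraction R} -> {fraction R}).
Local Notation "x %:F" := (FracField.tofrac x).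
Hypothesis DD : is_derivation D.

Lemma kills0 : D 0%:F = 0.
Proof. by apply: (addrI (D 0%:F)); rewrite -(proj1 DD) tofrac0 !addr0. Qed.

Lemma killsD x y : D x%:F = 0 -> D y%:F = 0 -> D (x + y)%:F = 0.
Proof. by move=> hx hy; rewrite tofracD (proj1 DD) hx hy addr0. Qed.

Lemma killsM x y : D x%:F = 0 -> D y%:F = 0 -> D (x * y)%:F = 0.
Proof. by move=> hx hy; rewrite tofracM (proj2 DD) hx hy mul0r mulr0 addr0. Qed.

Lemma kills_fraction : (forall p : R, D p%:F = 0) -> forall x, D x = 0.
Proof.
move=> Dpol x; have := fraction_numden x; move: (denom_ratioP (repr x)).
case: (frac (repr x)) => n d /= d0 e.
have f0 : d%:F != 0 by rewrite tofrac_eq0.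
have : D (x * d%:F) = 0 by rewrite {1}e mulfVK.
by rewrite (proj2 DD) Dpol mulr0 addr0 => /eqP; rewrite mulf_eq0 (negPf f0) orbF => /eqP.
Qed.
End KillFraction.

Section Generation.
Variables (F : fieldType) (I : choiceType).
Notation A := {malg F[{cmonom I}]}.
Variable D : {fraction A} -> {fraction A}.
Hypothesis DD : is_derivation D.
Hypothesis D_coef : forall x : F, D (FracField.tofrac (<< x *g mone >> : A)) = 0.
Hypothesis D_var : forall v : I, D (FracField.tofrac (<< 1 *g ucm v >> : A)) = 0.

Lemma derivation_eq0 x : D x = 0.
Proof.
have Dmon m : D (FracField.tofrac (<< 1 *g m >> : A)) = 0.
  elim/cmonom_ind: m => [|v m IH]; first exact: D_coef.
  have -> : << 1 *g mmul (ucm v) m >> = << 1 *g ucm v >> * << 1 *g m >> :> A.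
    by rewrite -[in LHS](mulr1 1); apply/esym/fgmulUU.
  exact: (killsM DD (D_var v) IH).
have Dpol p : D (FracField.tofrac (p : A)) = 0.
  elim/fpoly_ind: p => [|a m|p q hp hq]; first exact: (kills0 DD).
    have -> : << a *g m >> = << a *g mone >> * << 1 *g m >> :> A.
      by rewrite -[in LHS](mulr1 a) -[in LHS](mul1m m); apply/esym/fgmulUU.
    exact: (killsM DD (D_coef a) (Dmon m)).
  exact: (killsD DD).
exact: (kills_fraction DD).
Qed.
End Generation.

(** [E] is the field of rational functions over [F] in variables [b v]. Free prescription of
    derivations and their rigidity, the two clauses here, are all that later arguments know about
    [E]. *)
Lemma rational_functions (F : fieldType) (I : choiceType) :
  exists (E : fieldType) (c : {rmorphism F -> E}) (b : I -> E),
    (forall delta beta, derivation_along c delta ->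
       exists D : E -> E, [/\ is_derivation D, forall x, D (c x) = delta x
                            & forall v, D (b v) = beta v]) /\
    (forall D : E -> E, is_derivation D -> (forall x, D (c x) = 0) ->
       (forall v, D (b v) = 0) -> forall x, D x = 0).
Proof.
pose A := {malg F[{cmonom I}]}.
pose e := @FracField.tofrac A : {rmorphism A -> {fraction A}}.
pose c := e \o (fun x : F => << x *g mone >> : A) : {rmorphism F -> {fraction A}}.
exists {fraction A}, c, (fun v => e << 1 *g ucm v >>); split.
  move=> delta beta [dA dM].
  have dB : zmod_morphism delta.
    move=> x y; apply: (addIr (delta y)); by rewrite -dA subrK subrK.
  pose h := GRing.isZmodMorphism.Build _ _ delta dB.
  pose d' : {additive F -> {fraction A}} := HB.pack delta h.
  pose D := poly_der e d' beta.
  have DA p q : D (p + q) = D p + D q by exact: poly_derD.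
  have DM p q : D (p * q) = D p * e q + e p * D q.
    exact: poly_derM.
  have [D' [hD' D'E]] := fraction_derivation (conj DA DM).
  exists D'; split=> [//|x|v]; apply: (etrans (D'E _)); first exact: poly_derC.
  exact: poly_derX.
move=> D hD hc hb x; exact: derivation_eq0.
Qed.

End FreePolynomials.

(** * Subfields *)

Section Subfield.
Variables (L : fieldType) (P : L -> Prop).
Hypotheses (P1 : P 1) (PB : forall x y, P x -> P y -> P (x - y))
  (Pdiv : forall x y, P x -> P y -> P (x / y)).

Definition subfield_pred : pred L := fun x => asb (P x).

Lemma subfield_pred_closed : divring_closed subfield_pred.
Proof.
by split=> [|x y /asbP hx /asbP hy|x y /asbP hx /asbP hy]; apply/asbP; auto.
Qed.

HB.instance Definition _ := GRing.isDivringClosed.Build L subfield_pred subfield_pred_closed.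

Record subfield := Subfield { subfield_val : L; _ : subfield_val \in subfield_pred }.
HB.instance Definition _ := [isSub for subfield_val].
HB.instance Definition _ := [Choice of subfield by <:].
HB.instance Definition _ := [SubChoice_isSubIntegralDomain of subfield by <:].
HB.instance Definition _ := [SubIntegralDomain_isSubField of subfield by <:].

(** The set [P] becomes a field type of its own, so that it can serve as the coefficient field in
    [rational_functions]. *)
Lemma exists_subfield : exists (F : fieldType) (j : {rmorphism F -> L}),
  forall x, P x <-> exists y, j y = x.
Proof.
exists subfield, (val : {rmorphism subfield -> L}) => x; split=> [/asbP hx|[y <-]].
  by exists (Subfield hx).
by apply/asbP; exact: (valP y).
Qed.
End Subfield.

(** * The well-order on the indices *)

Section LexOrder.
Implicit Types s t u : seq nat.

Lemma lexle_total s t : lexle s t || lexle t s.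
Proof.
elim: s t => [|x s IH] [|y t] //=; case: (ltngtP x y) => //=.
Qed.

Lemma lexle_trans s t u : lexle s t -> lexle t u -> lexle s u.
Proof.
elim: s t u => [|x s IH] [|y t] [|z u] //=.
move=> /orP [h1|/andP [/eqP <- h1]] /orP [h2|/andP [/eqP <- h2]].
- by rewrite (ltn_trans h1 h2).
- by rewrite h1.
- by rewrite h2.
- by rewrite eqxx (IH _ _ h1 h2) orbT.
Qed.

Lemma lexle_anti s t : lexle s t -> lexle t s -> s = t.
Proof.
elim: s t => [|x s IH] [|y t] //=; case: (ltngtP x y) => //= -> h1 h2.
by rewrite (IH _ h1 h2).
Qed.

Lemma lexle_add (T : Type) (f g e : T -> nat) (l : seq T) :
  lexle [seq (f i + e i)%N | i <- l] [seq (g i + e i)%N | i <- l] =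
  lexle (map f l) (map g l).
Proof. by elim: l => //= i l ->; rewrite ltn_add2r eqn_add2r. Qed.
End LexOrder.

Lemma mabs_ge (m : nat) (xi : mindex m) i : (xi i <= mabs xi)%N.
Proof. by rewrite /mabs (bigD1 i) //= leq_addr. Qed.

Section Indices.
Variables m n : nat.
Definition vindex : Type := (mindex m * 'I_n)%type.
HB.instance Definition _ := Choice.on vindex.
Implicit Types v w : vindex.

Definition lev v : nat := mabs v.1.
Definition shift v (i : 'I_m) : vindex := (madd_eps v.1 i, v.2).
Definition unshift v (i : 'I_m) : vindex := ([ffun j => (v.1 j - (j == i))%N], v.2).

Lemma lev_shift v i : lev (shift v i) = (lev v).+1.
Proof.
rewrite /lev /mabs (eq_bigr (fun j => v.1 j + (j == i))%N); last by move=> j _; rewrite ffunE.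
rewrite big_split /= -addn1; congr addn.
by rewrite (bigD1 i) //= eqxx big1 // => j /negPf ->.
Qed.

Lemma shiftK v i : unshift (shift v i) i = v.
Proof.
case: v => v k; rewrite /unshift; congr (_, _); apply/ffunP => j.
by rewrite !ffunE /= addnK.
Qed.

Lemma unshiftK v i : (0 < v.1 i)%N -> shift (unshift v i) i = v.
Proof.
case: v => v k h; rewrite /shift /unshift; congr (_, _); apply/ffunP => j.
by rewrite !ffunE /=; have [->|_] := eqVneq j i; rewrite ?subn0 ?addn0 // subnK.
Qed.

Lemma shiftC v i j : shift (shift v i) j = shift (shift v j) i.
Proof. by congr (_, _); apply/ffunP => k; rewrite !ffunE /= addnAC. Qed.

Lemma shift_inj i : injective (shift^~ i).
Proof. by move=> v w e; rewrite -(shiftK v i) e shiftK. Qed.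

(* [tri_key] with the last coordinate kept: this makes the key injective and does not change the
   order, since the level determines that coordinate. *)
Definition key v : seq nat := [:: lev v, nat_of_ord v.2 & [seq v.1 i | i <- enum 'I_m]].

Lemma key_inj : injective key.
Proof.
move=> [v k] [w l] [] _ /val_inj /= -> /eq_in_map e; congr (_, _); apply/ffunP => i.
by apply: e; rewrite mem_enum.
Qed.

Lemma lexle_shift v w i : lexle (key (shift v i)) (key (shift w i)) = lexle (key v) (key w).
Proof.
rewrite /key /= !lev_shift ltnS eqSS -[RHS]/(lexle (key v) (key w)) /=.
rewrite -(lexle_add v.1 w.1 (fun j => j == i)).
by rewrite !(eq_map (ffunE _)).
Qed.

Definition vlt v w : bool := lexle (key v) (key w) && (v != w).

Lemma vlt_trans u v w : vlt u v -> vlt v w -> vlt u w.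
Proof.
move=> /andP [h1 n1] /andP [h2 n2]; rewrite /vlt (lexle_trans h1 h2).
apply: contra n1 => /eqP e; move: h2; rewrite -e => h2.
by rewrite (key_inj (lexle_anti h1 h2)).
Qed.

Lemma vlt_total v w : v != w -> vlt v w || vlt w v.
Proof. by move=> h; rewrite /vlt [w == v]eq_sym h !andbT lexle_total. Qed.

Lemma vlt_lev v w : vlt v w -> (lev v <= lev w)%N.
Proof. by case/andP => /= /orP [/ltnW|/andP [/eqP ->]]. Qed.

Definition vbox s : seq vindex :=
  [seq ([ffun i => nat_of_ord (u.1 i)], u.2) | u : {ffun 'I_m -> 'I_s.+1} * 'I_n].

Lemma mem_vbox s v : (lev v <= s)%N -> v \in vbox s.
Proof.
case: v => v k hv; apply/imageP.
have lt i : (v i < s.+1)%N by rewrite ltnS (leq_trans (mabs_ge v i)).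
exists ([ffun i => Ordinal (lt i)], k) => //=; congr (_, _).
by apply/ffunP => i; rewrite !ffunE.
Qed.

(** The predecessors of [v] have level at most [lev v], so they are finitely many. Counting them
    embeds the order into [nat], where comparison, induction and recursion take place. *)
Definition rk v : nat := size [seq w <- undup (vbox (lev v)) | vlt w v].

Lemma rk_vlt v w : vlt v w -> (rk v < rk w)%N.
Proof.
move=> vw; apply: (@uniq_leq_size _ (v :: [seq u <- undup (vbox (lev v)) | vlt u v])).
  by rewrite /= mem_filter /vlt eqxx andbF /= filter_uniq ?undup_uniq.
move=> u; rewrite inE mem_filter => /orP [/eqP ->|/andP [uv _]].
  by rewrite mem_filter vw mem_undup mem_vbox // vlt_lev.
have uw := vlt_trans uv vw.
by rewrite mem_filter uw mem_undup mem_vbox // vlt_lev.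
Qed.

Lemma vlt_rk v w : (rk v < rk w)%N = vlt v w.
Proof.
apply/idP/idP => [h|]; last exact: rk_vlt.
have [e|/vlt_total /orP [//|/rk_vlt]] := eqVneq v w; first by rewrite e ltnn in h.
by move/(ltn_trans h); rewrite ltnn.
Qed.

Lemma rk_inj : injective rk.
Proof.
move=> v w e; apply/eqP/negPn/negP => /vlt_total.
by rewrite -!vlt_rk e ltnn.
Qed.

Lemma rk_shift v w i : (rk v < rk w)%N -> (rk (shift v i) < rk (shift w i))%N.
Proof.
by rewrite !vlt_rk /vlt lexle_shift (inj_eq (@shift_inj i)).
Qed.

Lemma rk_lev v w : (lev v < lev w)%N -> (rk v < rk w)%N.
Proof.
move=> h; rewrite vlt_rk /vlt /= h /=.
by apply: contraTneq h => ->; rewrite ltnn.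
Qed.

Lemma rk_ltS v i : (rk v < rk (shift v i))%N.
Proof. by apply: rk_lev; rewrite lev_shift. Qed.

Lemma leq_rk_lev v w : (rk v <= rk w)%N -> (lev v <= lev w)%N.
Proof. by apply: contraTT; rewrite -!ltnNge => /rk_lev. Qed.
End Indices.

(** * Dickson's lemma and the choice of [s] *)

Section Dickson.

(** After each position the subsequence takes a place where the minimum of the remaining tail is
    attained; such minima never decrease. *)
Lemma monotone_subsequence (f : nat -> nat) :
  exists g : nat -> nat, {homo g : k l / (k < l)%N} /\ {homo f \o g : k l / (k <= l)%N}.
Proof.
have tail_min N : exists j, (N <= j)%N /\ forall l, (N <= l)%N -> (f j <= f l)%N.
  suff: forall k j, (N <= j)%N -> (f j < k)%N ->
      exists j, (N <= j)%N /\ forall l, (N <= l)%N -> (f j <= f l)%N.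
    by move/(_ (f N).+1 N (leqnn N) (leqnn _)).
  elim=> // k IH j hj fj.
  have [[l [hl fl]]|h] := classic (exists l, (N <= l)%N /\ (f l < f j)%N).
    by apply: (IH l hl); apply: leq_trans fl _.
  exists j; split=> // l hl; rewrite leqNgt; apply/negP => fl; apply: h; by exists l.
have [p hp] := choose_fun tail_min.
pose g := fix g k := if k is k'.+1 then p (g k').+1 else p 0%N.
have gS k : (g k < g k.+1)%N by case: (hp (g k).+1).
have gE k : exists N, (N <= g k)%N /\ g k = p N.
  by case: k => [|k] /=; [exists 0%N|exists (g k).+1].
have g_incr : {homo g : k l / (k < l)%N} by apply: homo_ltn => //; apply: ltn_trans.
exists g; split=> // k l; rewrite leq_eqVlt => /orP [/eqP ->//|kl] /=.
have [N [hN e]] := gE k; rewrite e; case: (hp N) => _; apply.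
exact: leq_trans hN (ltnW (g_incr _ _ kl)).
Qed.

Lemma monotone_subsequences (J : eqType) (T : Type) (h : J -> T -> nat) (x : nat -> T) (s : seq J) :
  exists g : nat -> nat, {homo g : k l / (k < l)%N} /\
    forall j, j \in s -> {homo (fun k => h j (x (g k))) : k l / (k <= l)%N}.
Proof.
elim: s => [|j s [g [g1 g2]]]; first by exists id; split=> // k l.
have [g' [g'1 g'2]] := monotone_subsequence (fun k => h j (x (g k))).
exists (g \o g'); split=> [k l kl|i]; first by exact: (g1 (g' k) (g' l) (g'1 _ _ kl)).
rewrite inE => /orP [/eqP ->|/g2 hi k l kl]; first exact: g'2.
apply: (hi (g' k) (g' l)).
by move: kl; rewrite leq_eqVlt => /orP [/eqP ->|/g'1 /ltnW].
Qed.

Variables m n : nat.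
Notation I := (vindex m n).
Implicit Types v w : I.

Definition vle v w : bool := (v.2 == w.2) && [forall i, (v.1 i <= w.1 i)%N].

Lemma dickson (x : nat -> I) : exists k l, (k < l)%N /\ vle (x k) (x l).
Proof.
(* The last components must be equal, not merely ordered: [v.2] and [n - v.2] are both nondecreasing
   only if [v.2] is constant. *)
pose h (j : 'I_m + bool) v : nat :=
  match j with inl i => v.1 i | inr true => v.2 | inr false => (n - v.2)%N end.
have [g [g1 g2]] := monotone_subsequences h x (enum {: 'I_m + bool}).
exists (g 0%N), (g 1%N); split; first exact: g1.
apply/andP; split.
  apply/eqP/val_inj/eqP; rewrite eqn_leq.
  rewrite (g2 (inr true) _ 0%N 1%N) ?mem_enum //=.
  have := g2 (inr false) (mem_enum _ _) 0%N 1%N isT; rewrite /h leq_sub2lE //.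
  exact: ltnW.
by apply/forallP => i; apply: (g2 (inl i) _ 0%N 1%N) => //; rewrite mem_enum.
Qed.

(** The bound on each entry leaves finitely many candidates for it, which provides the finite
    branching in Koenig's lemma. *)
Fixpoint controlled (R : nat -> nat) (s : seq I) : bool :=
  if s is v :: s' then (lev v <= R 0%N)%N && controlled (R \o succn) s' else true.

Definition bad (s : seq I) : bool := pairwise (fun v w => ~~ vle v w) s.

Lemma controlled_cat R s1 s2 :
  controlled R (s1 ++ s2) = controlled R s1 && controlled (fun k => R (size s1 + k)%N) s2.
Proof.
elim: s1 R => [|v s1 IH] R //=.
by rewrite IH andbA.
Qed.

Lemma controlled_nth R s :
  (forall d k, (k < size s)%N -> (lev (nth d s k) <= R k)%N) -> controlled R s.
Proof.
elim: s R => [|v s IH] R h //=.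
by rewrite (h v 0%N) //=; apply: IH => d k; exact: (h d k.+1).
Qed.

(* Koenig's lemma: otherwise there are arbitrarily long, hence infinite, controlled sequences
   without a pair [vle v w], against [dickson]. *)
Lemma bounded_bad_sequences (R : nat -> nat) :
  exists N, forall s, size s = N -> controlled R s -> ~~ bad s.
Proof.
pose cb s := controlled R s && bad s.
have cb_prefix s1 s2 : cb (s1 ++ s2) -> cb s1.
  by rewrite /cb controlled_cat /bad pairwise_cat => /andP [/andP [-> _] /and3P [_ -> _]].
pose inf s := forall N, exists u, size u = N /\ cb (s ++ u).
have [//|no] := classic (exists N, forall s, size s = N -> controlled R s -> ~~ bad s).
have inf0 : inf [::].
  move=> N; have [//|h] := classic (exists u, size u = N /\ cb ([::] ++ u)).
  case: no; exists N => s sN cs; apply/negP => bs; apply: h; exists s; split=> //.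
  by rewrite /cb /= cs.
have infS s : inf s -> exists v, inf (rcons s v).
  move=> hs; have [//|h] := classic (exists v, inf (rcons s v)).
  (* If no entry [v] continues [s] to arbitrary length, each one has a bound [N v]. The admissible
     entries lie in a finite box, and an extension of [s] longer than all their bounds is a
     contradiction. *)
  have hN v : exists N, forall u, size u = N -> ~~ cb (rcons s v ++ u).
    have [//|hv] := classic (exists N, forall u, size u = N -> ~~ cb (rcons s v ++ u)).
    case: h; exists v => N.
    have [//|hu] := classic (exists u, size u = N /\ cb (rcons s v ++ u)).
    by case: hv; exists N => u uN; apply/negP => cu; apply: hu; exists u.
  have [N hN'] := choose_fun hN.
  have [[|v u] [] //] := hs (\max_(v <- vbox m n (R (size s))) N v).+1.
  move=> [su] cu; have : v \in vbox m n (R (size s)).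
    apply: mem_vbox; move: cu; rewrite /cb controlled_cat /= addn0.
    by case/andP => /and3P [].
  move=> vin; have le : (N v <= size u)%N by rewrite su; exact: leq_bigmax_seq.
  have : size (take (N v) u) = N v by rewrite size_takel.
  move/hN' => /negP []; apply: (@cb_prefix _ (drop (N v) u)).
  by rewrite -catA cat_take_drop cat_rcons.
have [f hf] := choose_fun (fun s : {s | inf s} => infS _ (proj2_sig s)).
pose st := fix st k := if k is k'.+1 then exist inf _ (hf (st k')) else exist inf _ inf0.
pose x k := f (st k).
have stE k : proj1_sig (st k) = mkseq x k.
  by elim: k => //= k ->; rewrite /mkseq -addn1 iotaD map_cat /= cats1.
have [k [l [kl vkl]]] := dickson x.
have [u [_]] := proj2_sig (st l.+1) 0%N.
move/cb_prefix; rewrite stE => /andP [_ /(pairwiseP (x 0%N)) hp].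
have := hp k l; rewrite !inE size_mkseq !nth_mkseq ?ltnS ?(ltnW kl) // vkl.
by move=> /(_ isT (leqnn _) kl).
Qed.

Lemma vle_proper v w : vle v w -> v != w -> exists i, (v.1 i < w.1 i)%N.
Proof.
case: v w => v k [w l] /andP [/= /eqP <- /forallP h] ne.
have [i hi|e] := pickP (fun i => v i < w i)%N; first by exists i.
case/eqP: ne; congr (_, _); apply/ffunP => i; apply/eqP.
by rewrite eqn_leq h leqNgt e.
Qed.

Lemma vle_unshift v w i : vle v w -> (v.1 i < w.1 i)%N -> vle v (unshift w i).
Proof.
move=> /andP [h1 /forallP h2] hi; rewrite /vle h1 /=; apply/forallP => j; rewrite ffunE.
have [->|_] := eqVneq j i; last by rewrite subn0.
by move: hi; case: (w.1 i) => // k; rewrite subn1.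
Qed.

Lemma lev_unshift v i : (0 < v.1 i)%N -> lev v = (lev (unshift v i)).+1.
Proof. by move=> /unshiftK {1}<-; rewrite lev_shift. Qed.

Lemma upward_closed (P : I -> Prop) s :
  (forall v i, P v -> (lev v < s)%N -> P (shift v i)) ->
  forall v w, P v -> vle v w -> (lev w <= s)%N -> P w.
Proof.
move=> up v w Pv; have [k] := ubnP (lev w); elim: k w => // k IH w kw vw ws.
have [<-//|ne] := eqVneq v w.
have [i hi] := vle_proper vw ne.
have w0 : (0 < w.1 i)%N by apply: leq_ltn_trans hi.
have e := lev_unshift w0; rewrite -(unshiftK w0); apply: up; last by rewrite -e.
apply: IH; [by rewrite -ltnS -e|exact: vle_unshift|by apply: ltnW; rewrite -e].
Qed.

(** The bound [s] is fixed before [P]. If each of the [N] intervals from [R k + 1] to [R k.+1]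
    contained a minimal element of [P], these elements would form a controlled bad sequence of
    length [N], against the choice of [N]. *)
Lemma no_new_minimal r : exists s, (r <= s)%N /\ forall P : I -> Prop,
  (forall v i, P v -> (lev v < s)%N -> P (shift v i)) ->
  exists r', [/\ (r <= r')%N, (r'.*2 < s)%N &
    forall v, P v -> (r' < lev v <= r'.*2.+1)%N ->
      exists i, (0 < v.1 i)%N /\ P (unshift v i)].
Proof.
(* The successive candidates for [r']: as [R k.+1] is [(R k).*2.+1], the intervals that belong to
   them are consecutive. *)
pose R k := iter k (fun x => x.*2.+1) r.
have RS k : (R k < R k.+1)%N by rewrite /= ltnS -addnn leq_addr.
have R_incr : {homo R : k l / (k < l)%N} by apply: homo_ltn => //; apply: ltn_trans.
have R_mono : {homo R : k l / (k <= l)%N}.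
  by move=> k l; rewrite leq_eqVlt => /orP [/eqP ->//|/R_incr /ltnW].
have [N hN] := bounded_bad_sequences (R \o succn).
exists (R N); split=> [|P up]; first exact: (R_mono 0%N).
have [//|no] := classic (exists r', [/\ (r <= r')%N, (r'.*2 < R N)%N &
    forall v, P v -> (r' < lev v <= r'.*2.+1)%N -> exists i, (0 < v.1 i)%N /\ P (unshift v i)]).
have hv (k : 'I_N) : exists v, [/\ P v, (R k < lev v <= R k.+1)%N
    & forall i, (0 < v.1 i)%N -> ~ P (unshift v i)].
  have [//|h] := classic (exists v, [/\ P v, (R k < lev v <= R k.+1)%N
    & forall i, (0 < v.1 i)%N -> ~ P (unshift v i)]).
  case: no; exists (R k); split; first exact: (R_mono 0%N).
    by apply: leq_trans (R_mono _ _ (ltn_ord k)).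
  move=> v Pv lv; have [//|hi] := classic (exists i, (0 < v.1 i)%N /\ P (unshift v i)).
  by case: h; exists v; split=> // i vi Pi; apply: hi; exists i.
have [x hx] := choose_fun hv.
have sx : size [seq x k | k <- enum 'I_N] = N by rewrite size_map size_enum_ord.
have nthx d k (kN : (k < N)%N) : nth d [seq x k | k <- enum 'I_N] k = x (Ordinal kN).
  rewrite (nth_map (Ordinal kN)) ?size_enum_ord //; congr x.
  by apply/val_inj; rewrite /= nth_enum_ord.
have := hN _ sx; case/(_ _)/negP.
  apply: controlled_nth => d k; rewrite sx => kN; rewrite (nthx _ _ kN).
  by case: (hx (Ordinal kN)) => _ /andP [].
have [eN|N0] := posnP N; first by rewrite (size0nil (etrans sx eN)).
apply/(pairwiseP (x (Ordinal N0))) => k l; rewrite !inE sx => kN lN kl.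
rewrite !nthx; apply/negP => vkl.
have [Pk /andP [_ lk] _] := hx (Ordinal kN).
have [Pl /andP [ll lN'] minl] := hx (Ordinal lN).
have ne : x (Ordinal kN) != x (Ordinal lN).
  apply: contraTneq ll => <-; rewrite -leqNgt; apply: leq_trans lk _.
  exact: R_mono.
have [i hi] := vle_proper vkl ne.
have i0 : (0 < (x (Ordinal lN)).1 i)%N by apply: leq_ltn_trans hi.
apply: (minl i i0); apply: (upward_closed up Pk (vle_unshift vkl hi)).
apply: ltnW; rewrite -lev_unshift //; apply: leq_trans lN' _; exact: R_mono.
Qed.
End Dickson.

(** * Derivations on generated fields *)

Section GeneratedField.
Variables (F L : fieldType) (iota : F -> L) (I : Type) (a : I -> L) (S : I -> Prop).

(** An inductive closure instead of fractions of polynomials: it admits any set [S] of generators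
    and proofs by induction on the field operations. *)
Inductive genf : L -> Prop :=
| genf_const c : genf (iota c)
| genf_var v : S v -> genf (a v)
| genfD x y : genf x -> genf y -> genf (x + y)
| genfM x y : genf x -> genf y -> genf (x * y)
| genfV x : genf x -> genf x^-1.
End GeneratedField.

Section GeneratedFieldTheory.
Variables (F L : fieldType) (iota : {rmorphism F -> L}) (I : Type) (a : I -> L).
Implicit Type S : I -> Prop.
Local Notation gen := (genf iota a).

Lemma genf_sub S S' x : (forall v, S v -> S' v) -> gen S x -> gen S' x.
Proof.
move=> sub; elim=> [c|v /sub Sv|y z _ hy _ hz|y z _ hy _ hz|y _ hy].
- exact: genf_const.
- exact: genf_var.
- exact: genfD.
- exact: genfM.
- exact: genfV.
Qed.

Lemma genf0 S : gen S 0.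
Proof. by rewrite -(rmorph0 iota); exact: genf_const. Qed.

Lemma genf1 S : gen S 1.
Proof. by rewrite -(rmorph1 iota); exact: genf_const. Qed.

Lemma genfN S x : gen S x -> gen S (- x).
Proof.
by move=> hx; rewrite -mulN1r -(rmorph1 iota) -rmorphN; apply: genfM => //; exact: genf_const.
Qed.

Lemma genfX S x k : gen S x -> gen S (x ^+ k).
Proof. by move=> hx; elim: k => [|k IH]; rewrite ?exprS; [exact: genf1|exact: genfM]. Qed.

Lemma genf_sum S (J : Type) (r : seq J) (P : pred J) (f : J -> L) :
  (forall j, P j -> gen S (f j)) -> gen S (\sum_(j <- r | P j) f j).
Proof. by move=> h; elim/big_ind: _ => //; [exact: genf0|exact: genfD]. Qed.
End GeneratedFieldTheory.

Section DerivationOn.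
Variables (L E : fieldType) (c : {rmorphism L -> E}) (G : L -> Prop).
Hypotheses (G0 : G 0) (G1 : G 1) (GV : forall x, G x -> G x^-1).

Definition der_on (D : L -> E) : Prop :=
  forall x y, G x -> G y -> D (x + y) = D x + D y /\ D (x * y) = D x * c y + c x * D y.

Variable D : L -> E.
Hypothesis hD : der_on D.

Lemma der_on0 : D 0 = 0.
Proof. by apply: (addrI (D 0)); rewrite -(proj1 (hD G0 G0)) !addr0. Qed.

Lemma der_on1 : D 1 = 0.
Proof.
by have := proj2 (hD G1 G1); rewrite !mulr1 rmorph1 mulr1 mul1r -{1}(addr0 (D 1)) => /addrI.
Qed.

Lemma der_onV x : G x -> D x^-1 = - (D x / c x ^+ 2).
Proof.
move=> hx; have [->|x0] := eqVneq x 0.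
  by rewrite invr0 der_on0 mul0r oppr0.
have := proj2 (hD hx (GV hx)); rewrite divff // der_on1 fmorphV => /esym/eqP.
rewrite addrC addr_eq0 => /eqP e.
have cx0 : c x != 0 by rewrite fmorph_eq0.
by apply: (mulfI cx0); rewrite e mulrN; congr (- _); rewrite mulrCA expr2 invfM mulVKf.
Qed.
End DerivationOn.

(** * The differential condition as a family of derivations *)

(** The greatest index of level [s] consists of [(s, 0, ..., 0)] and [n - 1]. The differential
    condition at this single index covers all polynomials in the variables of level at most [s]. *)
Lemma tri_le_top (m s n : nat) : exists sigma : mindex m.+1, mabs sigma = s /\
  forall (xi : mindex m.+1) k, (k < n)%N -> tri_le xi k sigma n.-1 = (mabs xi <= s)%N.
Proof.
pose sigma : mindex m.+1 := [ffun i => if i == ord0 then s else 0%N].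
have ms : mabs sigma = s.
  rewrite /mabs big_ord_recl ffunE eqxx big1 ?addn0 // => i _.
  by rewrite ffunE.
exists sigma; split=> // xi k kn.
rewrite /tri_le /tri_key /= ms.
case: (ltngtP (mabs xi) s) => //= e.
have kn1 : (k <= n.-1)%N by case: n kn.
case: (ltngtP k n.-1) kn1 => //= _ _.
have [->|ne] := eqVneq xi sigma.
  by have := lexle_total (take m [seq sigma i | i <- enum 'I_m.+1])
    (take m [seq sigma i | i <- enum 'I_m.+1]); rewrite orbb.
have lt0 : (xi ord0 < s)%N.
  rewrite ltn_neqAle -{2}e mabs_ge andbT; apply: contra ne => /eqP x0.
  apply/eqP/ffunP => i; rewrite ffunE; case: eqP => [->//|/eqP i0].
  move: e; rewrite /mabs (bigD1 ord0) //= x0 -[RHS]addn0 => /addnI.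
  by rewrite (bigD1 i) //= => /eqP; rewrite addn_eq0 => /andP [/eqP].
have s0 : sigma ord0 = s by rewrite ffunE.
move: sigma s0 {ms ne} xi e lt0 => sigma s0 xi e lt0; rewrite !enum_ordSl.
case: m sigma s0 xi e lt0 => [|m] sigma s0 xi e lt0 //=.
by rewrite s0 lt0.
Qed.

Section Evaluation.
Variables (m n s : nat) (K L : fieldType) (iota : {rmorphism K -> L}).
Variable a : mindex m -> nat -> L.
Local Notation nv := (nvars m n s).
Implicit Types (p q : {mpoly K[nv]}) (j : 'I_nv).

Definition var_value (v : vindex m n) : L := a v.1 v.2.
Definition var_index (j : 'I_nv) : vindex m n := (vxi (var_of j), (val (var_of j)).2).

Lemma var_index_onto (v : vindex m n) : (lev v <= s)%N -> exists j, var_index j = v.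
Proof.
case: v => v k hv.
have lt i : (v i < s.+1)%N by rewrite ltnS (leq_trans (mabs_ge v i)).
pose u : {ffun 'I_m -> 'I_s.+1} * 'I_n := ([ffun i => Ordinal (lt i)], k).
have hu : (\sum_(i < m) (u.1 i : nat) <= s)%N.
  by rewrite (eq_bigr (fun i => v i)) // => i _; rewrite ffunE.
exists (enum_rank (Sub u hu : vidx m n s)).
rewrite /var_index /var_of enum_rankK; congr (_, _); apply/ffunP => i.
by rewrite !ffunE.
Qed.

Lemma lev_var_index j : (lev (var_index j) <= s)%N.
Proof.
rewrite /lev /mabs (eq_bigr (fun i => ((val (var_of j)).1 i : nat))).
  exact: (valP (var_of j)).
by move=> i _; rewrite ffunE.
Qed.

Definition ev : {mpoly K[nv]} -> L := mmap iota (fun j => var_value (var_index j)).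

HB.instance Definition _ := GRing.RMorphism.copy ev (mmap iota (fun j => var_value (var_index j))).

Lemma evC c : ev c%:MP = iota c.
Proof. by rewrite /ev mmapC. Qed.

Lemma evX j : ev 'X_j = var_value (var_index j).
Proof. by rewrite /ev mmapX mmap1U. Qed.

Lemma ev_genf p : genf iota var_value (fun v => lev v <= s)%N (ev p).
Proof.
rewrite /ev /mmap; apply: genf_sum => mon _; apply: genfM; first exact: genf_const.
rewrite /mmap1; elim/big_ind: _ => [||j _]; [exact: genf1|by move=> *; apply: genfM|].
by apply: genfX; apply: genf_var; exact: lev_var_index.
Qed.

Lemma in_gen_field_genf x : in_gen_field n s iota a x ->
  genf iota var_value (fun v => lev v <= s)%N x.
Proof. by move=> [p [q [_ ->]]]; apply: genfM; [|apply: genfV]; exact: ev_genf. Qed.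
End Evaluation.

Section DifferentialCondition.
Variables (m n s : nat) (K L : fieldType) (iota : {rmorphism K -> L}).
Variable a : mindex m -> nat -> L.
Variable d : {additive K -> K}.
Hypothesis dM : forall x y, d (x * y) = d x * y + x * d y.
Local Notation nv := (nvars m n s.+1).
Local Notation ev := (@ev m n s.+1 K L iota a).
Local Notation idx := (@var_index m n s.+1).
Local Notation av := (@var_value m n L a).
Implicit Types (p q : {mpoly K[nv]}) (j : 'I_nv).
Variable i : 'I_m.

Definition low_vars p : Prop :=
  forall mon, mon \in msupp p -> forall j, ~~ (lev (idx j) <= s)%N -> mon j = 0%N.

(** The left side of the differential condition at the greatest index of level [s]. For [p] in
    [low_vars], it is the only possible value at [ev p] of a derivation that extends [d] and takes
    each [av v] to [av (shift v i)]. *)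
Definition prolong p : L :=
  \sum_(j < nv | (lev (idx j) <= s)%N) ev (mderiv j p) * av (shift (idx j) i)
  + ev (map_mpoly d p).

Lemma map_mpoly_der p q :
  map_mpoly d (p * q) = map_mpoly d p * q + p * map_mpoly d q.
Proof.
apply/mpolyP => mon; rewrite mcoeff_map_mpoly mcoeffD !mcoeffM raddf_sum -big_split /=.
by apply: eq_bigr => k _; rewrite !mcoeff_map_mpoly dM.
Qed.

Lemma prolong_der : derivation_along ev prolong.
Proof.
split=> p q; rewrite /prolong.
  rewrite raddfD /= rmorphD /= addrACA -big_split /=; congr (_ + _).
  by apply: eq_bigr => j _; rewrite mderivD rmorphD mulrDl.
rewrite map_mpoly_der rmorphD !rmorphM /= mulrDl mulrDr addrACA; congr (_ + _).
rewrite mulr_suml mulr_sumr -big_split /=; apply: eq_bigr => j _.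
by rewrite mderivM rmorphD !rmorphM /=; ring.
Qed.

Lemma low_varsC c : low_vars c%:MP.
Proof.
move=> mon; rewrite msuppC; case: ifP => // _; rewrite inE => /eqP -> j _.
by rewrite mnm0E.
Qed.

Lemma low_varsX j : (lev (idx j) <= s)%N -> low_vars 'X_j.
Proof.
move=> lj mon; rewrite msuppX inE => /eqP -> k.
by rewrite mnm1E; case: eqP => // <-; rewrite lj.
Qed.

Lemma low_varsD p q : low_vars p -> low_vars q -> low_vars (p + q).
Proof. by move=> hp hq mon /msuppD_le; rewrite mem_cat => /orP [/hp|/hq]. Qed.

Lemma low_varsN p : low_vars p -> low_vars (- p).
Proof. by move=> hp mon; rewrite (perm_mem (msuppN _)) => /hp. Qed.

Lemma low_varsM p q : low_vars p -> low_vars q -> low_vars (p * q).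
Proof.
move=> hp hq mon /msuppM_le /allpairsP [[m1 m2] [/= h1 h2 ->]] j lj.
by rewrite mnmDE (hp _ h1 _ lj) (hq _ h2 _ lj).
Qed.

Hypothesis prolong_ker : forall p, low_vars p -> ev p = 0 -> prolong p = 0.

Local Notation G := (genf iota av (fun v => lev v <= s)%N).

Lemma genf_quotient x : G x -> is_quotient ev low_vars x.
Proof.
have l1 := @low_varsC 1; have e1 : ev 1 != 0 by rewrite rmorph1 oner_neq0.
elim=> [c|v lv|y z _ [p [q [lp lq q0 ->]]] _ [p' [q' [lp' lq' q'0 ->]]]
  |y z _ [p [q [lp lq q0 ->]]] _ [p' [q' [lp' lq' q'0 ->]]]|y _ [p [q [lp lq q0 ->]]]].
- exists c%:MP, 1; split=> //; first exact: low_varsC.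
  by rewrite rmorph1 divr1; exact/esym/evC.
- have [j ej] := @var_index_onto m n s.+1 v (leq_trans lv (leqnSn _)).
  exists 'X_j, 1; split=> //; first by apply: low_varsX; rewrite ej.
  by rewrite rmorph1 divr1 /= -[v]ej; exact/esym/evX.
- exists (p * q' + p' * q), (q * q'); split; last 2 first.
  + by rewrite rmorphM mulf_neq0.
  + by rewrite addf_div // rmorphD !rmorphM.
  + by apply: low_varsD; apply: low_varsM.
  + exact: low_varsM.
- exists (p * p'), (q * q'); split; [exact: low_varsM|exact: low_varsM| |].
  + by rewrite rmorphM mulf_neq0.
  + by rewrite mulf_div !rmorphM.
have [p0|p0] := eqVneq (ev p) 0; last by exists q, p; split; rewrite ?invf_div.
exists 0, 1; split=> //; first by rewrite -mpolyC0; exact: low_varsC.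
by rewrite /= p0 !rmorph0 mul0r invr0 mul0r.
Qed.

Lemma prolong_derivation : exists D : L -> L,
  [/\ der_on idfun G D, forall c, D (iota c) = iota (d c)
    & forall v : vindex m n, (lev v <= s)%N -> D (av v) = av (shift v i)].
Proof.
have [||||D [D1 D2]] := quotient_derivation _ _ _ _ prolong_der prolong_ker.
- exact: low_varsC.
- exact: low_varsD.
- exact: low_varsN.
- exact: low_varsM.
exists D; split=> [x y hx hy|c|v lv].
- by have := D1 x y (genf_quotient hx) (genf_quotient hy).
- have -> : iota c = ev c%:MP by exact/esym/evC.
  rewrite (D2 _ (@low_varsC c)) /prolong.
  rewrite map_mpolyC evC big1 ?add0r // => j _.
  by rewrite mderivC rmorph0 mul0r.
have [j ej] := @var_index_onto m n s.+1 v (leq_trans lv (leqnSn _)).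
have lj : (lev (idx j) <= s)%N by rewrite ej.
have -> : av v = ev 'X_j by rewrite -[v]ej; exact/esym/evX.
rewrite (D2 _ (low_varsX lj)) /prolong (bigD1 j) //=.
have der_var : map_mpoly d 'X_j = 0.
  apply/mpolyP => mon; rewrite mcoeff_map_mpoly mcoeffX mcoeff0.
  have d1 : d 1 = 0.
    by have := dM 1 1; rewrite !mulr1 mul1r -{1}(addr0 (d 1)) => /addrI.
  by case: eqP; rewrite ?raddf0.
rewrite der_var rmorph0 addr0 big1 ?addr0 => [|k /andP [_ kj]].
  have -> : mderiv j 'X_j = 1 :> {mpoly K[nv]}.
    rewrite mderivX mnm1E eqxx scale1r -mpolyX0; congr ('X_[_]).
    by apply/mnmP => l; rewrite mnmBE subnn mnm0E.
  by rewrite rmorph1 mul1r ej.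
by rewrite mderivX mnm1E eq_sym (negPf kj) scale0r rmorph0 mul0r.
Qed.
End DifferentialCondition.

(** By [tri_le_top] the condition says that [prolong] vanishes on relations. The bound [s.+1] yields
    derivations on level [s], since their values reach level [s.+1]. *)
Lemma differential_condition_derivation (m n s : nat) (hm : (0 < m)%N) (hn : (0 < n)%N)
  (K L : fieldType) (d : 'I_m -> K -> K) (iota : {rmorphism K -> L}) (a : mindex m -> nat -> L) :
  (forall i, is_derivation (d i)) -> differential_condition n s.+1 d iota a ->
  forall i, exists D : L -> L,
  [/\ der_on idfun (genf iota (@var_value m n L a) (fun v => lev v <= s)%N) D,
      forall c, D (iota c) = iota (d i c)
    & forall v : vindex m n, (lev v <= s)%N ->
        D (var_value a v) = var_value a (shift v i)].
Proof.
move=> d_der dc; case: m hm d iota a d_der dc => // {}m _ {}d {}iota {}a d_der dc i.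
have [dA dM] := d_der i.
have dB : zmod_morphism (d i) by move=> x y; apply: (addIr (d i y)); rewrite -dA !subrK.
pose d' : {additive K -> K} := HB.pack (d i) (GRing.isZmodMorphism.Build K K (d i) dB).
apply: (@prolong_derivation _ _ _ _ _ _ _ d') => //.
move=> p lp p0.
have [sigma [sigmas top]] := tri_le_top m s n.
have topj j : tri_le (@vxi m.+1 n s.+1 (var_of j)) (vh (var_of j)) sigma n.-1 =
    (lev (var_index j) <= s)%N by exact: top (ltn_ord _).
have := dc i n.-1 sigma _ _ p _ p0; rewrite prednK // sigmas addn1 => /(_ (leqnn _) (leqnn _)).
have h mon : mon \in msupp p ->
    forall j, ~~ tri_le (vxi (var_of j)) (vh (var_of j)) sigma n.-1 -> mon j = 0%N.
  by move=> mp j; rewrite topj; exact: lp.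
by move/(_ h); rewrite (eq_bigl _ _ topj).
Qed.
(** * Extension beyond level [t + 1] *)

Section RankRecursion.
Variables (I E : Type) (rank : I -> nat) (e0 : E) (Phi : (I -> E) -> I -> E).
Hypothesis Phi_ext : forall alpha beta v,
  (forall w, (rank w < rank v)%N -> alpha w = beta w) -> Phi alpha v = Phi beta v.

(** Iterating [Phi] more than [rank v] times no longer changes the value at [v]; the solution takes
    this stable value. *)
Lemma rank_recursion : exists alpha, forall v, alpha v = Phi alpha v.
Proof.
pose A N := iter N Phi (fun=> e0).
have stable N M v : (rank v < N)%N -> (rank v < M)%N -> A N v = A M v.
  have [k] := ubnP (rank v); elim: k N M v => // k IH [|N] [|M] v // vk vN vM.
  by apply: Phi_ext => w wv; apply: IH; apply: leq_trans wv _.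
exists (fun v => A (rank v).+1 v) => v.
by apply: Phi_ext => w wv; apply: stable.
Qed.
End RankRecursion.

Section DerivationsOnGenerated.
Variables (F E : fieldType) (c : {rmorphism F -> E}) (I : Type) (b : I -> E).
Local Notation gen := (genf c b).

Lemma derivation_eq_gen (D1 D2 : E -> E) (S : I -> Prop) :
  is_derivation D1 -> is_derivation D2 -> (forall x, D1 (c x) = D2 (c x)) ->
  (forall v, S v -> D1 (b v) = D2 (b v)) -> forall x, gen S x -> D1 x = D2 x.
Proof.
move=> [A1 M1] [A2 M2] hc hb x.
have d1 : der_on idfun (fun=> True) D1 by split; [exact: A1|exact: M1].
have d2 : der_on idfun (fun=> True) D2 by split; [exact: A2|exact: M2].
elim=> [k|v|y z _ hy _ hz|y z _ hy _ hz|y _ hy]; [exact: hc|exact: hb| | |].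
- by rewrite A1 A2 hy hz.
- by rewrite M1 M2 hy hz.
- by rewrite (der_onV _ _ _ d1) // (der_onV _ _ _ d2) // hy.
Qed.

Lemma derivation_gen_stable (D : E -> E) (S S' : I -> Prop) :
  is_derivation D -> (forall x, gen S' (D (c x))) ->
  (forall v, S v -> S' v /\ gen S' (D (b v))) -> forall x, gen S x -> gen S' (D x).
Proof.
move=> [DA DM] hc hb x.
have sub y : gen S y -> gen S' y by apply: genf_sub => v /hb [].
have d : der_on idfun (fun=> True) D by split; [exact: DA|exact: DM].
elim=> [k|v|y z _ hy _ hz|y z gy hy gz hz|y gy hy]; [exact: hc|by move/hb => []| | |].
- by rewrite DA; exact: genfD.
- by rewrite DM; apply: genfD; apply: genfM => //; exact: sub.
- rewrite (der_onV _ _ _ d) //; apply: genfN; apply: genfM => //; apply: genfV.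
  by apply: genfX; exact: sub.
Qed.
End DerivationsOnGenerated.

Lemma derivation_along_kill (K F E : fieldType) (c : {rmorphism F -> E}) (kF : K -> F)
  (I : Type) (e : I -> F) (S : I -> Prop) (X : F -> E) :
  derivation_along c X -> (forall k, X (kF k) = 0) -> (forall v, S v -> X (e v) = 0) ->
  forall x, genf kF e S x -> X x = 0.
Proof.
move=> [XA XM] hk he x.
have d : der_on c (fun=> True) X by split; [exact: XA|exact: XM].
elim=> [k|v|y z _ hy _ hz|y z _ hy _ hz|y _ hy]; [exact: hk|exact: he| | |].
- by rewrite XA hy hz addr0.
- by rewrite XM hy hz mul0r mulr0 addr0.
- by rewrite (der_onV _ _ _ d) // hy mul0r oppr0.
Qed.

Lemma commutator_derivation (E : fieldType) (D1 D2 : E -> E) :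
  is_derivation D1 -> is_derivation D2 -> is_derivation (fun x => D1 (D2 x) - D2 (D1 x)).
Proof.
move=> [A1 M1] [A2 M2]; split=> x y; first by rewrite A1 A2 A1 A2 opprD addrACA.
rewrite M2 M1 A1 A2 !M1 !M2.
move: (D1 (D2 x)) (D2 (D1 x)) (D1 (D2 y)) (D2 (D1 y)) => p q r s.
by rewrite !mulrBl !mulrBr; ring.
Qed.

Section Core.
Variables (m n t : nat) (K F E : fieldType).
Local Notation I := (vindex m n).
Implicit Types (v w z : I) (i j l : 'I_m).
Variables (d : 'I_m -> K -> K) (kF : K -> F) (c : {rmorphism F -> E}) (b : I -> E).
Hypothesis d_comm : forall i j x, d i (d j x) = d j (d i x).
Hypothesis free : forall delta beta, derivation_along c delta ->
  exists D : E -> E, [/\ is_derivation D, forall x, D (c x) = delta x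
                       & forall v, D (b v) = beta v].
Hypothesis rigid : forall D : E -> E, is_derivation D -> (forall x, D (c x) = 0) ->
  (forall v, D (b v) = 0) -> forall x, D x = 0.
(* [e] lists the generators of [F], [al0] prescribes the values up to level [t + 1], and [Lam] is
   the set of leaders continued to all levels. *)
Variables (delta : 'I_m -> F -> E) (al0 : I -> E) (e : I -> F) (Lam : pred I).
Hypothesis delta_der : forall i, derivation_along c (delta i).
Hypothesis delta_K : forall i k, delta i (kF k) = c (kF (d i k)).
Hypothesis al0_low : forall v, (lev v <= t)%N -> al0 v = c (e v).
Hypothesis delta_e : forall i v, (lev v <= t)%N -> delta i (e v) = al0 (shift v i).
Hypothesis F_gen : forall x : F, genf kF e (fun v => lev v <= t)%N x.

Definition parametric v : bool := (t < lev v)%N && ~~ Lam v.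
Local Notation gen := (genf c b).

Hypothesis al0_param : forall v, lev v = t.+1 -> ~~ Lam v -> al0 v = b v.
Hypothesis al0_lead : forall v, lev v = t.+1 -> Lam v ->
  gen (fun w => parametric w /\ (rk w < rk v)%N) (al0 v).
Hypothesis delta_gen : forall i x, gen (fun w => parametric w /\ lev w = t.+1) (delta i x).
Hypothesis lead_kill : forall v (X : F -> E), lev v = t -> Lam v -> derivation_along c X ->
  (forall k, X (kF k) = 0) -> (forall w, (rk w < rk v)%N -> X (e w) = 0) -> X (e v) = 0.
Hypothesis Lam_up : forall v i, Lam v -> Lam (shift v i).
Hypothesis Lam_down : forall v, Lam v -> (t < lev v)%N ->
  exists w i, v = shift w i /\ Lam w.
Hypothesis Lam_connect : forall v w i j, shift v i = shift w j -> i != j -> Lam v -> Lam w ->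
  (t < lev v)%N ->
  (exists u, [/\ Lam u, v = shift u j & w = shift u i]) \/
  exists l u u', [/\ Lam u, Lam u', v = shift u l, w = shift u' l & shift u i = shift u' j].

Lemma core_extension : exists D : 'I_m -> E -> E,
  [/\ commuting_derivations D, forall i x, D i (c x) = delta i x
    & forall i k, D i (c (kF k)) = c (kF (d i k))].
Proof.
have [m0|i0] : m = 0%N \/ inhabited 'I_m.
- by case: (m) => [|m']; [left|right; exact: (inhabits ord0)].
- have noI : 'I_m -> False by rewrite m0; case.
  by exists (fun _ _ => 0); split; [split|move|move] => i; case: (noI i).
case: i0 => i0.
have [ext ext_spec] := choose_fun (fun p : 'I_m * (I -> E) =>
  free p.2 (delta_der p.1)).
(* A leader [z] beyond level [t + 1] is reached from another leader in at least one direction;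
   [jj z] fixes one, through which the value at [z] is defined. *)
have hjj v : exists i, Lam v && (t.+1 < lev v)%N -> exists w, v = shift w i /\ Lam w.
  have [/andP [Lv lv]|_] := boolP (Lam v && _); last by exists i0.
  by have [w [i [-> Lw]]] := Lam_down Lv (ltnW lv); exists i => _; exists w.
have [jj jjP] := choose_fun hjj.
(* Cutting [alpha] off at the rank of [z] makes the recursion well-founded; [alpha_spec] shows
   that the cut is invisible. *)
pose below_beta (alpha : I -> E) z v : E :=
  if parametric v && (rk (shift v (jj z)) < rk z)%N then alpha (shift v (jj z)) else 0.
pose Phi alpha z :=
  if (lev z <= t.+1)%N then al0 z
  else if Lam z then ext (jj z, below_beta alpha z) (alpha (unshift z (jj z)))
  else b z.
have [alpha alphaE] : exists alpha, forall z, alpha z = Phi alpha z.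
  apply: (rank_recursion (rank := @rk m n) 0) => f g z fg; rewrite /Phi.
  case: leqP => // lz; case: ifP => // Lz.
  have [w [ez _]] : exists w, z = shift w (jj z) /\ Lam w by apply: jjP; rewrite Lz lz.
  have -> : below_beta f z = below_beta g z.
    apply: functional_extensionality => v.
    by rewrite /below_beta; case: ifP => // /andP [_ /fg ->].
  by congr (ext _ _); apply: fg; rewrite {1}ez shiftK ez rk_ltS.
(* For [v] not parametric, [b v] is made a constant, so that commutators vanish on it. *)
pose beta i v := if parametric v then alpha (shift v i) else 0.
pose D i := ext (i, beta i).
have D_der i : is_derivation (D i) by have [h1 h2 h3] := ext_spec (i, beta i).
have D_c i x : D i (c x) = delta i x.
  by have [h1 h2 h3] := ext_spec (i, beta i); exact: h2.
have D_b i v : D i (b v) = if parametric v then alpha (shift v i) else 0.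
  by have [h1 h2 h3] := ext_spec (i, beta i); exact: h3.
have alpha_low z : (lev z <= t.+1)%N -> alpha z = al0 z by move=> lz; rewrite alphaE /Phi lz.
have alpha_param z : parametric z -> alpha z = b z.
  move=> /andP [lz nLz]; have [lz'|lz'] := leqP (lev z) t.+1.
    by rewrite alpha_low // al0_param //; apply/eqP; rewrite eqn_leq lz' lz.
  by rewrite alphaE /Phi leqNgt lz' /= (negPf nLz).
pose Slt z w := parametric w /\ (rk w < rk z)%N.
pose Sle z w := parametric w /\ (rk w <= rk z)%N.
have alpha_lead z : Lam z -> (t.+1 < lev z)%N -> exists w, [/\ z = shift w (jj z), Lam w &
    alpha z = ext (jj z, below_beta alpha z) (alpha w)].
  move=> Lz lz; have [|w [ez Lw]] := jjP z; first by rewrite Lz lz.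
  exists w; split=> //; rewrite alphaE /Phi leqNgt lz /= Lz.
  by congr (ext _ (alpha _)); rewrite {1}ez shiftK.
(* The value at a leader involves only parameters strictly before it. Hence, if [z = shift w (jj z)]
   for a leader [w], the cut derivation and [D (jj z)] agree on [alpha w]. *)
have alpha_spec z : (t < lev z)%N -> gen (Sle z) (alpha z) /\ (Lam z -> gen (Slt z) (alpha z) /\
    ((t.+1 < lev z)%N -> exists w, [/\ z = shift w (jj z), Lam w & alpha z = D (jj z) (alpha w)])).
  have [k] := ubnP (rk z); elim: k z => // k IH z zk lz.
  have lele y : gen (Slt z) y -> gen (Sle z) y.
    by apply: genf_sub => w [pw /ltnW wz].
  have [Lz|nLz] := boolP (Lam z); last first.
    split=> //; have pz : parametric z by rewrite /parametric lz.
    by rewrite alpha_param //; apply: genf_var; split.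
  have [lz'|lz'] := leqP (lev z) t.+1.
    have gz : gen (Slt z) (alpha z).
      by rewrite alpha_low //; apply: al0_lead => //; apply/eqP; rewrite eqn_leq lz' lz.
    by split=> [|_]; [exact: lele|split].
  have [w [ez Lw aE]] := alpha_lead z Lz lz'.
  have wz : (rk w < rk z)%N by rewrite ez rk_ltS.
  have lw : (t < lev w)%N by move: lz'; rewrite ez lev_shift.
  have [_ /(_ Lw) [gw _]] := IH w (leq_trans wz zk) lw.
  have shift_lt v : (rk v < rk w)%N -> (rk (shift v (jj z)) < rk z)%N.
    by move=> vw; rewrite {2}ez rk_shift.
  have aE' : alpha z = D (jj z) (alpha w).
    have [x1 x2 x3] := ext_spec (jj z, below_beta alpha z).
    rewrite aE; apply: (derivation_eq_gen (c := c) (b := b)) gw => //.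
      by move=> x; rewrite D_c x2.
    by move=> v [pv vw]; rewrite x3 D_b /= /below_beta pv shift_lt.
  have gz : gen (Slt z) (alpha z).
    rewrite aE'; apply: (derivation_gen_stable (c := c) (b := b)) gw => //.
      move=> x; rewrite D_c; apply: genf_sub (delta_gen _ _) => v [pv lv]; split=> //.
      by apply: rk_lev; rewrite lv.
    move=> v [pv vw]; split; first by split=> //; exact: ltn_trans wz.
    rewrite D_b pv; have sz := shift_lt v vw.
    have [|g1 _] := IH (shift v (jj z)) (leq_trans sz zk).
      by rewrite lev_shift ltnW // ltnS; case/andP: pv.
    by apply: genf_sub g1 => u [pu uz]; split=> //; exact: leq_ltn_trans sz.
  split=> [|_]; first exact: lele.
  by split=> // _; exists w.
pose X i j x := D i (D j x) - D j (D i x).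
have X_der i j : is_derivation (X i j) by exact: commutator_derivation.
have D_K i k : D i (c (kF k)) = c (kF (d i k)) by rewrite D_c delta_K.
have X_K i j k : X i j (c (kF k)) = 0 by rewrite /X !D_K d_comm subrr.
have X_c i j : derivation_along c (X i j \o c).
  have [A M] := X_der i j; split=> x y /=; first by rewrite rmorphD A.
  by rewrite rmorphM M.
(* The central claim, by induction on the rank of [shift v i]: at leaders the value does not depend
   on the direction chosen by [jj]. *)
have Cl v i : D i (alpha v) = alpha (shift v i).
  have [k] := ubnP (rk (shift v i)); elim: k v i => // k IH v i vk.
  have [lv|lv] := leqP (lev v) t.
    rewrite (alpha_low v) ?al0_low // ?D_c ?delta_e ?alpha_low ?lev_shift //.
    exact: leq_trans lv _.
  have [Lv|nLv] := boolP (Lam v); last first.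
    have pv : parametric v by rewrite /parametric lv.
    by rewrite (alpha_param v pv) D_b pv.
  pose z := shift v i.
  have swap u a a' : shift (shift u a) a' = z -> Lam u ->
      D a' (alpha (shift u a)) = D a (alpha (shift u a')).
    move=> ez Lu.
    have lu : (t <= lev u)%N.
      by move: lv; rewrite -ltnS -[(lev v).+1](lev_shift v i) -/z -ez !lev_shift !ltnS.
    have zk : (rk z < k.+1)%N by [].
    have lt w' : (rk w' < rk z)%N -> (rk w' < k)%N by move/leq_trans; apply.
    (* For [w] before [u] the induction hypothesis applies, since all indices passed through lie
       before [z]. *)
    have Xk w : (rk w < rk u)%N -> X a' a (alpha w) = 0.
      move=> wu; have w2 : (rk (shift (shift w a) a') < rk z)%N by rewrite -ez !rk_shift.
      have w2' : (rk (shift (shift w a') a) < rk z)%N by rewrite shiftC.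
      have w1 : (rk (shift w a) < rk z)%N by apply: ltn_trans w2; exact: rk_ltS.
      have w1' : (rk (shift w a') < rk z)%N by apply: ltn_trans w2'; exact: rk_ltS.
      by rewrite /X (IH w a) ?(IH w a') ?(IH _ a') ?(IH _ a) ?lt // shiftC subrr.
    suff /subr0_eq : X a' a (alpha u) = 0.
      have -> : D a (alpha u) = alpha (shift u a) by rewrite IH // lt // -ez rk_ltS.
      have -> // : D a' (alpha u) = alpha (shift u a').
      by rewrite IH // lt // -ez shiftC rk_ltS.
    (* On level [t] the value at [u] comes from [F], and [lead_kill] applies. Above it, [alpha u] is
       generated over [F] by earlier parameters, and the commutator vanishes on all these
       generators. *)
    move: lu; rewrite leq_eqVlt => /orP [/eqP lu|lu].
      rewrite alpha_low -?lu // al0_low -?lu //.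
      apply: (lead_kill (esym lu) Lu (X_c a' a)) => [x|w wu] /=; first exact: X_K.
      have lw : (lev w <= t)%N by rewrite lu; apply: leq_rk_lev; exact: ltnW.
      by rewrite -al0_low // -alpha_low ?Xk // leqW.
    have [_ /(_ Lu) [gu _]] := alpha_spec u lu.
    have Xc x : X a' a (c x) = 0.
      apply: (derivation_along_kill (X_c a' a) (X_K a' a) _ (F_gen x)) => w lw /=.
      rewrite -al0_low // -alpha_low ?(leqW lw) // Xk //.
      by apply: rk_lev; exact: leq_ltn_trans lu.
    apply: (derivation_along_kill (c := idfun) (kF := c) _ Xc _ gu) => [|w [pw wu]].
      exact: X_der.
    by rewrite -alpha_param ?Xk.
  have Lz : Lam z by exact: Lam_up.
  have lz : (t.+1 < lev z)%N by rewrite lev_shift.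
  have [|_ /(_ Lz) [_ /(_ lz) [w [ez Lw aE]]]] := alpha_spec z; first exact: ltnW.
  rewrite -/z aE; have [eij|ij] := eqVneq i (jj z).
    by rewrite -eij; congr (D _ (alpha _)); apply: (@shift_inj _ _ i); rewrite {2}eij -ez.
  (* With a common predecessor one exchange of derivatives suffices; otherwise the third direction
     [l] links the two choices by two exchanges. *)
  have [[u [Lu ev ew]]|[l [u [u' [Lu Lu' ev ew euu]]]]] := Lam_connect ez ij Lv Lw lv.
    by rewrite ev ew; apply: swap => //; rewrite -ev.
  rewrite ev ew swap -?ev // euu swap // -euu.
  by rewrite shiftC -ev.
have X_alpha i j v : X i j (alpha v) = 0 by rewrite /X !Cl shiftC subrr.
have Xc i j x : X i j (c x) = 0.
  apply: (derivation_along_kill (X_c i j) (X_K i j) _ (F_gen x)) => w lw /=.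
  by rewrite -al0_low // -alpha_low ?(leqW lw) // X_alpha.
exists D; split=> //; split=> // i j x; apply/subr0_eq.
apply: (rigid (X_der i j)) => [y|v]; first exact: Xc.
have [pv|npv] := boolP (parametric v); first by rewrite -alpha_param // X_alpha.
have D0 k : D k 0 = 0.
  by apply: (addrI (D k 0)); rewrite -(proj1 (D_der k)) !addr0.
by rewrite /X !D_b (negPf npv) !D0 subrr.
Qed.
End Core.

(** * Leaders *)

Section DerivationOfRoot.
Variables (L E : fieldType) (c : {rmorphism L -> E}) (G : L -> Prop).
Hypotheses (G0 : G 0) (GD : forall x y, G x -> G y -> G (x + y))
  (GM : forall x y, G x -> G y -> G (x * y)).
Variables (D : L -> E) (W : E -> Prop).
Hypothesis hD : der_on c G D.
Hypotheses (W0 : W 0) (WD : forall x y, W x -> W y -> W (x + y))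
  (WZ : forall x y, G x -> W y -> W (c x * y)).

Lemma horner_closed (q : {poly L}) x : (forall k, G q`_k) -> G x -> G q.[x].
Proof.
elim/poly_ind: q => [|p a IH] hq hx; first by rewrite horner0.
rewrite hornerMXaddC; apply: GD; last by have := hq 0%N; rewrite coefD coefMX coefC add0r.
apply: GM => //; apply: IH => // k.
by have := hq k.+1; rewrite coefD coefMX coefC addr0.
Qed.

(** [y] is the value at [x] of [q] with [D] applied to its coefficients; only its membership in [W]
    is recorded. [W] will be a subfield, a linear span or the zero set. *)
Lemma derivation_horner (q : {poly L}) x :
  (forall k, G q`_k) -> G x -> (forall k, W (D q`_k)) ->
  exists2 y, W y & D q.[x] = y + c q^`().[x] * D x.
Proof.
elim/poly_ind: q => [|p a IH] hq hx hW.
  exists 0 => //; rewrite horner0 deriv0 horner0 rmorph0 mul0r addr0.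
  exact: (der_on0 G0 hD).
have hp k : G p`_k by have := hq k.+1; rewrite coefD coefMX coefC addr0.
have ha : G a by have := hq 0%N; rewrite coefD coefMX coefC add0r.
have Wp k : W (D p`_k) by have := hW k.+1; rewrite coefD coefMX coefC addr0.
have Wa : W (D a) by have := hW 0%N; rewrite coefD coefMX coefC add0r.
have [y Wy e] := IH hp hx Wp; have gp := horner_closed hp hx.
exists (c x * y + D a); first by apply: WD => //; apply: WZ.
rewrite hornerMXaddC (proj1 (hD (GM gp hx) ha)) (proj2 (hD gp hx)) e.
rewrite derivD derivC addr0 derivM derivX mulr1 hornerD hornerMX rmorphD rmorphM /=; ring.
Qed.

(** Differentiating [q.[x] = 0] gives a linear equation for [D x], which is solvable because [x] is
    a simple root. *)
Lemma derivation_root (q : {poly L}) x :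
  (forall k, G q`_k) -> G x -> (forall k, W (D q`_k)) ->
  q.[x] = 0 -> q^`().[x] != 0 -> exists2 y, W y & D x = - (c q^`().[x])^-1 * y.
Proof.
move=> hq hx hW qx q'x; have [y Wy] := derivation_horner hq hx hW.
rewrite qx (der_on0 G0 hD) => /esym/eqP; rewrite addrC addr_eq0 => /eqP e; exists y => //.
have cq : c q^`().[x] != 0 by rewrite fmorph_eq0.
by apply: (mulfI cq); rewrite e mulNr mulrN mulVKf.
Qed.
End DerivationOfRoot.

Section Leaders.
Variables (m n : nat) (K L : fieldType) (iota : {rmorphism K -> L}).
Local Notation I := (vindex m n).
Implicit Types (v w z : I) (i : 'I_m).
Variable a : I -> L.
Local Notation gen := (genf iota a).

Definition below v w : Prop := (rk w < rk v)%N.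

(** A simple root is asked for, rather than a separable minimal polynomial; both say that [a v] is
    separably algebraic over its predecessors. *)
Definition leader v : Prop := exists q : {poly L},
  [/\ forall k, gen (below v) q`_k, q.[a v] = 0 & q^`().[a v] != 0].

Lemma rational_leader v : gen (below v) (a v) -> leader v.
Proof.
move=> h; exists ('X - (a v)%:P); split=> [k||].
- rewrite coefB coefX coefC; apply: genfD; first by case: eqP => _; [exact: genf1|exact: genf0].
  by apply: genfN; case: eqP => // _; exact: genf0.
- by rewrite hornerXsubC subrr.
by rewrite derivXsubC hornerC oner_neq0.
Qed.

Variables (t : nat) (d : 'I_m -> K -> K) (D : 'I_m -> L -> L).
Hypothesis D_der : forall i, der_on idfun (gen (fun v => lev v <= t)%N) (D i).
Hypothesis D_K : forall i k, D i (iota k) = iota (d i k).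
Hypothesis D_var : forall i v, (lev v <= t)%N -> D i (a v) = a (shift v i).

(* The set of values [W] is a variable so that the same computation serves for subfields of [L]
   and for linear spans. *)
Lemma derivation_gen (S : I -> Prop) (W : L -> Prop) i :
  (forall v, S v -> lev v <= t)%N ->
  (forall k, W (iota k)) -> (forall x y, W x -> W y -> W (x + y)) ->
  (forall x y, gen S x -> W y -> W (x * y)) ->
  (forall v, S v -> W (a (shift v i))) -> forall x, gen S x -> W (D i x).
Proof.
move=> low WK WD WZ Wv x.
have sub y : gen S y -> gen (fun v => lev v <= t)%N y by exact: genf_sub.
have gk k : gen S (iota k) by exact: genf_const.
elim=> [k|v Sv|y z gy hy gz hz|y z gy hy gz hz|y gy hy].
- by rewrite D_K.
- by rewrite D_var; [exact: Wv|exact: low].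
- by rewrite (proj1 (D_der _ (sub _ gy) (sub _ gz))); apply: WD.
- rewrite (proj2 (D_der _ (sub _ gy) (sub _ gz))) /=; apply: WD; last exact: WZ.
  by rewrite mulrC; apply: WZ.
rewrite (der_onV (genf0 _ _ _) (genf1 _ _ _) _ (D_der i)) //=; last 2 first.
- exact: genfV.
- exact: sub.
by rewrite mulrC -mulNr; apply: WZ => //; apply: genfN; apply: genfV; apply: genfX.
Qed.

(** Differentiating the equation of [a v] expresses [a (shift v i)] rationally by [a v] and the
    values at [w] and [shift w i] for [w] before [v]; all these precede [shift v i]. *)
Lemma leader_shift v i : leader v -> (lev v <= t)%N -> gen (below (shift v i)) (a (shift v i)).
Proof.
move=> [q [hq qv q'v]] lv.
pose S w := (rk w <= rk v)%N.
have low w : S w -> (lev w <= t)%N by move=> /leq_rk_lev /leq_trans; apply.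
have Sb w : below v w -> S w by exact: ltnW.
have St w : S w -> below (shift v i) w.
  by move=> wv; apply: leq_ltn_trans wv _; exact: rk_ltS.
have gS x : gen S x -> gen (below (shift v i)) x by exact: genf_sub.
have gS' x : gen (below v) x -> gen S x by exact: genf_sub.
have dS : der_on idfun (gen S) (D i).
  by move=> x y hx hy; apply: D_der; apply: genf_sub low _.
have av : gen S (a v) by apply: genf_var; exact: leqnn.
have [|x y|x y||x y|x y hx|k|k|y Wy] := @derivation_root _ _ idfun (gen S) _ _ _ (D i)
  (gen (below (shift v i))) dS _ _ _ q (a v) _ av _ qv q'v.
- exact: genf0.
- exact: genfD.
- exact: genfM.
- exact: genf0.
- exact: genfD.
- by move=> gy; apply: genfM => //; exact: gS.
- exact: gS'.
- apply: (@derivation_gen (below v)) (hq k).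
  + by move=> w /Sb; exact: low.
  + by move=> k'; exact: genf_const.
  + by move=> *; exact: genfD.
  + by move=> x y /gS' /gS hx hy; exact: genfM.
  + by move=> w wv; apply: genf_var; rewrite /below rk_shift.
rewrite D_var //= => ->; apply: genfM => //; apply: genfN; apply: genfV.
apply: gS; apply: (@horner_closed _ _ _ _ _ (q^`())) => //.
- exact: genf0.
- by move=> *; exact: genfD.
- by move=> *; exact: genfM.
move=> k; rewrite coef_deriv -mulr_natr -(rmorph_nat iota).
by apply: genfM; [exact: gS'|exact: genf_const].
Qed.
End Leaders.

(** * Making the nonleaders of level [t + 1] generic *)

Section Linearization.
Variables (m n : nat) (K L : fieldType) (iota : {rmorphism K -> L}).
Local Notation I := (vindex m n).
Implicit Types (v w z : I) (i : 'I_m) (S : I -> Prop).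
Variables (a : I -> L) (t : nat) (d : 'I_m -> K -> K) (D : 'I_m -> L -> L).
Local Notation gen := (genf iota a).
Local Notation low := (fun v => lev v <= t)%N.
Local Notation leader := (leader iota a).
Hypothesis D_der : forall i, der_on idfun (gen low) (D i).
Hypothesis D_K : forall i k, D i (iota k) = iota (d i k).
Hypothesis D_var : forall i v, (lev v <= t)%N -> D i (a v) = a (shift v i).
Variables (F E : fieldType) (j : {rmorphism F -> L}) (c : {rmorphism F -> E}) (b : I -> E).
Hypothesis j_onto : forall x, gen low x <-> exists y, j y = x.
Hypothesis leader_down : forall v, leader v -> lev v = t.+1 ->
  exists w i, v = shift w i /\ leader w.

Definition params : seq I :=
  [seq v <- undup (vbox m n t.+1) | (lev v == t.+1) && ~~ asb (leader v)].

Lemma mem_params v : v \in params <-> lev v = t.+1 /\ ~ leader v.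
Proof.
rewrite mem_filter mem_undup; split=> [/andP [/andP [/eqP -> /asbP]] //|[lv nl]].
by rewrite lv eqxx mem_vbox ?lv // andbT; apply/asbP.
Qed.

Lemma uniq_params : uniq params.
Proof. by rewrite filter_uniq // undup_uniq. Qed.

Lemma j_gen S x : (forall v, low v -> S v) -> gen S (j x).
Proof. by move=> sub; apply: genf_sub sub _; apply/j_onto; exists x. Qed.

(* A nonleader of level [t + 1] is not rational over its predecessors. *)
Lemma params_free x0 (g : I -> F) :
  j x0 + \sum_(v <- params) j (g v) * a v = 0 -> x0 = 0 /\ forall v, v \in params -> g v = 0.
Proof.
move=> e; pose B := (\max_(v <- params) rk v)%N.
(* Downward induction on the rank: once the coefficients at later indices vanish, a nonzero [g v]
   would make [a v] rational over its predecessors. *)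
have g0 : forall v, v \in params -> g v = 0.
  move=> v; have [k] := ubnP (B - rk v)%N; elim: k v => // k IH v vk vp.
  have [//|gv] := eqVneq (g v) 0; have /mem_params [lv []] := vp.
  apply: rational_leader.
  have jl x : gen (below v) (j x).
    by apply: j_gen => w lw; apply: rk_lev; rewrite lv ltnS.
  have jgv : j (g v) != 0 by rewrite fmorph_eq0.
  have -> : a v = - (j (g v))^-1 * (j x0 + \sum_(w <- params | w != v) j (g w) * a w).
    move: e; rewrite (bigD1_seq v) ?uniq_params //= addrCA => /eqP.
    rewrite addr_eq0 => /eqP e; apply: (mulfI jgv); rewrite e mulrA mulrN mulfV //.
    by rewrite mulN1r.
  apply: genfM; first by apply: genfN; apply: genfV.
  apply: genfD => //; rewrite big_seq_cond; apply: genf_sum => w /andP [wp wv].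
  have [vw|vw] := ltnP (rk v) (rk w).
    rewrite IH ?rmorph0 ?mul0r //; first exact: genf0.
    have wB : (rk w <= B)%N by exact: leq_bigmax_seq.
    apply: leq_trans (_ : (B - rk v) <= k)%N; last by rewrite -ltnS.
    by apply: ltn_sub2l => //; exact: leq_trans wB.
  apply: genfM => //; apply: genf_var; rewrite /below ltn_neqAle vw andbT.
  by apply: contra wv => /eqP /rk_inj ->.
split=> //; move: e; rewrite big_seq big1 ?addr0 => [/eqP|w wp].
  by rewrite fmorph_eq0 => /eqP.
by rewrite g0 // rmorph0 mul0r.
Qed.

(* The graph of the [F]-linear map that sends [1] to [1] and [a v] to [b v] for [v] in [params],
   restricted to combinations of the [a v] with [S v]. *)
Definition lin_graph S (x : L) (y : E) : Prop := exists x0 (g : I -> F),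
  [/\ forall v, g v != 0 -> S v, x = j x0 + \sum_(v <- params) j (g v) * a v
    & y = c x0 + \sum_(v <- params) c (g v) * b v].

Definition in_span S x : Prop := exists y, lin_graph S x y.

Lemma lin_graph_sub S S' x y : (forall v, S v -> S' v) -> lin_graph S x y -> lin_graph S' x y.
Proof. by move=> sub [x0 [g [hg hx hy]]]; exists x0, g; split=> // v /hg /sub. Qed.

Lemma lin_graphC S x : lin_graph S (j x) (c x).
Proof.
exists x, (fun=> 0); split=> [v||]; first by rewrite eqxx.
- by rewrite big1 ?addr0 // => v _; rewrite rmorph0 mul0r.
by rewrite big1 ?addr0 // => v _; rewrite rmorph0 mul0r.
Qed.

Lemma lin_graphX S v : v \in params -> S v -> lin_graph S (a v) (b v).
Proof.
move=> vp Sv; exists 0, (fun w => (w == v)%:R); split=> [w||].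
- by case: (eqVneq w v) => [->|]; rewrite ?eqxx.
- rewrite rmorph0 add0r (bigD1_seq v) ?uniq_params //= eqxx rmorph1 mul1r big1 ?addr0 //.
  by move=> w /negPf ->; rewrite rmorph0 mul0r.
rewrite rmorph0 add0r (bigD1_seq v) ?uniq_params //= eqxx rmorph1 mul1r big1 ?addr0 //.
by move=> w /negPf ->; rewrite rmorph0 mul0r.
Qed.

Lemma lin_graphD S x y x' y' :
  lin_graph S x y -> lin_graph S x' y' -> lin_graph S (x + x') (y + y').
Proof.
move=> [x0 [g [hg -> ->]]] [x0' [g' [hg' -> ->]]].
exists (x0 + x0'), (fun v => g v + g' v); split=> [v||].
- by case: (eqVneq (g v) 0) => [->|/hg //]; rewrite add0r => /hg'.
- rewrite rmorphD /= addrACA -big_split /=; congr (_ + _).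
  by apply: eq_bigr => v _; rewrite rmorphD mulrDl.
rewrite rmorphD /= addrACA -big_split /=; congr (_ + _).
by apply: eq_bigr => v _; rewrite rmorphD mulrDl.
Qed.

Lemma lin_graphZ S k x y : lin_graph S x y -> lin_graph S (j k * x) (c k * y).
Proof.
move=> [x0 [g [hg -> ->]]]; exists (k * x0), (fun v => k * g v); split=> [v||].
- by rewrite mulf_eq0 negb_or => /andP [_ /hg].
- rewrite mulrDr rmorphM mulr_sumr; congr (_ + _); apply: eq_bigr => v _.
  by rewrite rmorphM mulrA.
rewrite mulrDr rmorphM mulr_sumr; congr (_ + _); apply: eq_bigr => v _.
by rewrite rmorphM mulrA.
Qed.

Lemma lin_graph_fun S S' x y y' : lin_graph S x y -> lin_graph S' x y' -> y = y'.
Proof.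
move=> [x0 [g [_ -> ->]]] [x0' [g' [_ e ->]]].
have [|e0 eg] := @params_free (x0 - x0') (fun v => g v - g' v).
  under eq_bigr => v _ do rewrite rmorphB mulrBl.
  by rewrite sumrB rmorphB addrACA -opprD e subrr.
rewrite (subr0_eq e0); congr (_ + _); rewrite !big_seq; apply: eq_bigr => v vp.
by rewrite (subr0_eq (eg v vp)).
Qed.

Lemma lin_graph_genf S x y : lin_graph S x y ->
  genf c b (fun v => S v /\ v \in params) y.
Proof.
move=> [x0 [g [hg _ ->]]]; apply: genfD; first exact: genf_const.
rewrite big_seq; apply: genf_sum => v vp.
have [->|/hg Sv] := eqVneq (g v) 0; first by rewrite rmorph0 mul0r; exact: genf0.
by apply: genfM; [exact: genf_const|exact: genf_var].
Qed.

Lemma in_spanZ S x y : gen low x -> in_span S y -> in_span S (x * y).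
Proof. by move=> /j_onto [k <-] [z hz]; exists (c k * z); exact: lin_graphZ. Qed.

Lemma in_spanD S x y : in_span S x -> in_span S y -> in_span S (x + y).
Proof. by move=> [x' hx] [y' hy]; exists (x' + y'); exact: lin_graphD. Qed.

Lemma in_span_low S x : gen low x -> in_span S x.
Proof. by move/j_onto => [y <-]; exists (c y); exact: lin_graphC. Qed.

(** By [leader_down] a leader of level [t + 1] is [shift w i] for a leader [w] of level [t].
    Differentiating the equation of [a w] gives a relation linear in the derivatives, with scalars
    of level at most [t]; so the value stays in the span of 1 and earlier nonleaders. *)
Lemma value_in_span z : (lev z <= t.+1)%N ->
  in_span (fun w => rk w <= rk z)%N (a z) /\
  (leader z -> lev z = t.+1 -> in_span (below z) (a z)).
Proof.
have [k] := ubnP (rk z); elim: k z => // k IH z zk.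
rewrite leq_eqVlt ltnS => /orP [/eqP lz|lz]; last first.
  split; first by apply: in_span_low; exact: genf_var.
  by move=> _ e; rewrite e ltnn in lz.
have [Lz|nLz] := classic (leader z); last first.
  split=> //; exists (b z); apply: lin_graphX => //; exact/mem_params.
suff h : in_span (below z) (a z).
  by split=> //; case: h => y hy; exists y; apply: lin_graph_sub hy => w /ltnW.
have [w [i [ez [q [hq qw q'w]]]]] := leader_down Lz lz.
have lw : (lev w <= t)%N by move: lz; rewrite ez lev_shift => -[->].
have wl v : below w v -> (lev v <= t)%N.
  by move=> /ltnW /leq_rk_lev /leq_trans; apply.
have gl x : gen (below w) x -> gen low x by exact: genf_sub.
have aw : gen low (a w) by apply: genf_var.
have [|x y|x y||x y|x y|u|u|y Wy] := @derivation_root _ _ idfun (gen low) _ _ _ (D i)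
  (in_span (below z)) (D_der i) _ _ _ q (a w) _ aw _ qw q'w.
- exact: genf0.
- exact: genfD.
- exact: genfM.
- by apply: in_span_low; exact: genf0.
- exact: in_spanD.
- exact: in_spanZ.
- exact: gl.
- apply: (derivation_gen D_der D_K D_var (S := below w)) (hq u) => //.
  + by move=> y; apply: in_span_low; exact: genf_const.
  + exact: in_spanD.
  + by move=> x y /gl; exact: in_spanZ.
  move=> v vw; have sz : (rk (shift v i) < rk z)%N by rewrite ez rk_shift.
  have [|[y hy] _] := IH (shift v i) (leq_trans sz zk).
    by rewrite lev_shift ltnS; exact: wl.
  by exists y; apply: lin_graph_sub hy => u' us; exact: leq_ltn_trans sz.
rewrite D_var // -ez /= => ->; apply: in_spanZ => //.
apply: genfN; apply: genfV; apply: (@horner_closed _ _ _ _ _ (q^`())).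
- exact: genf0.
- by move=> *; exact: genfD.
- by move=> *; exact: genfM.
- move=> u; rewrite coef_deriv -mulr_natr -(rmorph_nat iota); apply: genfM; first exact: gl.
  exact: genf_const.
exact: genf_var.
Qed.

Lemma derivative_in_span i x : gen low x -> in_span (fun=> True) (D i x).
Proof.
apply: (derivation_gen D_der D_K D_var (S := low)) => //.
- by move=> k; apply: in_span_low; exact: genf_const.
- exact: in_spanD.
- by move=> *; exact: in_spanZ.
move=> v lv; have [|[y hy] _] := @value_in_span (shift v i); first by rewrite lev_shift.
by exists y; apply: lin_graph_sub hy.
Qed.

Variables (kF : {rmorphism K -> F}) (e : I -> F).
Hypotheses (j_kF : forall k, j (kF k) = iota k)
  (j_e : forall v, (lev v <= t)%N -> j (e v) = a v).

Lemma pullback_genf S x : (forall v, S v -> low v) -> gen S x -> exists2 y, j y = x & genf kF e S y.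
Proof.
move=> sub; elim=> [k|v Sv|y z _ [y' <- hy] _ [z' <- hz]|y z _ [y' <- hy] _ [z' <- hz]
  |y _ [y' <- hy]].
- by exists (kF k) => //; exact: genf_const.
- by exists (e v); [rewrite j_e //; exact: sub|exact: genf_var].
- by exists (y' + z'); [rewrite rmorphD|exact: genfD].
- by exists (y' * z'); [rewrite rmorphM|exact: genfM].
by exists y'^-1; [rewrite fmorphV|exact: genfV].
Qed.

(** The equation of [a v] is pulled back to [F]; [X] kills its coefficients, hence its simple root
    [e v]. This provides [lead_kill] in [core_extension]. *)
Lemma leader_kill v (X : F -> E) : lev v = t -> leader v -> derivation_along c X ->
  (forall k, X (kF k) = 0) -> (forall w, (rk w < rk v)%N -> X (e w) = 0) -> X (e v) = 0.
Proof.
move=> lv [q [hq qv q'v]] X_der X_K X_e.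
have wl w : below v w -> (lev w <= t)%N by move=> /ltnW /leq_rk_lev; rewrite lv.
have hp k : exists y, j y = q`_k /\ genf kF e (below v) y.
  by have [y e1 e2] := pullback_genf wl (hq k); exists y.
have [p hp'] := choose_fun hp.
pose r := \poly_(k < size q) p k.
have er : map_poly j r = q.
  apply/polyP => k; rewrite coef_map coef_poly; case: ltnP => kq /=; first by case: (hp' k).
  by rewrite rmorph0 nth_default.
have rv : r.[e v] = 0.
  by apply/eqP; rewrite -(fmorph_eq0 j) -horner_map er j_e ?lv // qv.
have r'v : r^`().[e v] != 0.
  by rewrite -(fmorph_eq0 j) -horner_map -deriv_map er j_e ?lv.
have [XA XM] := X_der.
have Xon : der_on c (fun=> True) X by split; [exact: XA|exact: XM].
have Xr k : X r`_k = 0.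
  rewrite coef_poly; case: ifP => _; last exact: (der_on0 _ Xon).
  by case: (hp' k) => _; exact: (derivation_along_kill X_der X_K).
have W0D (x y : E) : x = 0 -> y = 0 -> x + y = 0 by move=> -> ->; rewrite addr0.
have W0M (x : F) (y : E) : True -> y = 0 -> c x * y = 0 by move=> _ ->; rewrite mulr0.
have [y -> ->] := @derivation_root _ _ c (fun=> True) Logic.I (fun _ _ _ _ => Logic.I)
  (fun _ _ _ _ => Logic.I) X (fun y => y = 0) Xon erefl W0D W0M r (e v)
  (fun=> Logic.I) Logic.I Xr rv r'v.
by rewrite mulr0.
Qed.

Variable Lam : pred I.
Hypothesis LamP : forall v, (lev v <= t.+1)%N -> Lam v <-> leader v.
Hypothesis d_comm : forall i1 i2 x, d i1 (d i2 x) = d i2 (d i1 x).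
Hypothesis free : forall delta beta, derivation_along c delta ->
  exists D : E -> E, [/\ is_derivation D, forall x, D (c x) = delta x
                       & forall v, D (b v) = beta v].
Hypothesis rigid : forall D : E -> E, is_derivation D -> (forall x, D (c x) = 0) ->
  (forall v, D (b v) = 0) -> forall x, D x = 0.
Hypothesis Lam_up : forall v i, Lam v -> Lam (shift v i).
Hypothesis Lam_down : forall v, Lam v -> (t < lev v)%N ->
  exists w i, v = shift w i /\ Lam w.
Hypothesis Lam_connect : forall v w i1 i2, shift v i1 = shift w i2 -> i1 != i2 -> Lam v -> Lam w ->
  (t < lev v)%N ->
  (exists u, [/\ Lam u, v = shift u i2 & w = shift u i1]) \/
  exists l u u', [/\ Lam u, Lam u', v = shift u l, w = shift u' l & shift u i1 = shift u' i2].

(** [D i] leads out of [F], into the span of 1 and the nonleaders of level [t + 1]. Followed by the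
    linear map [lam], which sends these nonleaders to the [b v], it becomes a derivation [delta i]
    of [F] into [E], and [core_extension] continues it. *)
Lemma extend_derivations : exists D' : 'I_m -> E -> E,
  [/\ commuting_derivations D', forall i k, D' i (c (kF k)) = c (kF (d i k))
    & forall i v, (lev v < t)%N -> D' i (c (e v)) = c (e (shift v i))].
Proof.
have hlam x : exists y, forall y', lin_graph (fun=> True) x y' -> y = y'.
  have [[y hy]|h] := classic (in_span (fun=> True) x); last first.
    by exists 0 => y' hy'; case: h; exists y'.
  by exists y => y'; exact: (lin_graph_fun hy).
have [lam lamP'] := choose_fun hlam.
have lamP S x y : lin_graph S x y -> lam x = y.
  by move=> h; apply: lamP'; apply: lin_graph_sub h.
have lamC x : lam (j x) = c x by apply: (lamP (fun=> True)); exact: lin_graphC.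
have lowj x : gen low (j x) by apply/j_onto; exists x.
pose delta i x := lam (D i (j x)).
have delta_der i : derivation_along c (delta i).
  split=> x y; rewrite /delta.
    rewrite rmorphD (proj1 (D_der _ (lowj x) (lowj y))).
    have [u hu] := derivative_in_span i (lowj x); have [v hv] := derivative_in_span i (lowj y).
    by rewrite (lamP _ _ _ hu) (lamP _ _ _ hv); apply: (lamP _ _ _ (lin_graphD hu hv)).
  rewrite rmorphM (proj2 (D_der _ (lowj x) (lowj y))) /=.
  have [u hu] := derivative_in_span i (lowj x); have [v hv] := derivative_in_span i (lowj y).
  rewrite (lamP _ _ _ hu) (lamP _ _ _ hv) [D i _ * _]mulrC [u * _]mulrC.
  exact: (lamP _ _ _ (lin_graphD (lin_graphZ y hu) (lin_graphZ x hv))).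
have [D' [D'comm D'c D'K]] : exists D' : 'I_m -> E -> E,
  [/\ commuting_derivations D', forall i x, D' i (c x) = delta i x
    & forall i k, D' i (c (kF k)) = c (kF (d i k))].
  apply: (@core_extension m n t K F E d kF c b d_comm free rigid delta
    (fun v => lam (a v)) e Lam) => //.
  - by move=> i k; rewrite /delta j_kF D_K -j_kF lamC.
  - by move=> v lv; rewrite -j_e // lamC.
  - by move=> i v lv; rewrite /delta j_e // D_var.
  - move=> x; have [y /fmorph_inj <- //] := pullback_genf (fun v h => h) (lowj x).
  - move=> v lv nL; apply: (lamP (fun=> True)); apply: lin_graphX => //; apply/mem_params.
    by split=> //; move/LamP; rewrite lv => /(_ (leqnn _)); exact/negP.
  - move=> v lv Lv; have /LamP Lv' := Lv; have [|_] := @value_in_span v; first by rewrite lv.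
    move=> /(_ (Lv' _) lv) [|y hy]; first by rewrite lv.
    rewrite (lamP _ _ _ hy); apply: genf_sub (lin_graph_genf hy) => w [wv /mem_params [lw nw]].
    split=> //; rewrite /parametric lw leqnn /=; apply/negP => /LamP; rewrite lw => /(_ (leqnn _)).
    exact: nw.
  - move=> i x; have [y hy] := derivative_in_span i (lowj x); rewrite /delta (lamP _ _ _ hy).
    apply: genf_sub (lin_graph_genf hy) => w [_ /mem_params [lw nw]]; split=> //.
    rewrite /parametric lw leqnn /=; apply/negP => /LamP; rewrite lw => /(_ (leqnn _)).
    exact: nw.
  - move=> v X lv /LamP; rewrite lv => /(_ (leqnSn _)); exact: leader_kill.
(* If [lev v < t], then [shift v i] still has level at most [t], where its value lies in [F] and
   [lam] agrees with [c]. *)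
exists D'; split=> // i v lv; rewrite D'c /delta j_e ?(ltnW lv) // D_var ?(ltnW lv) //.
by rewrite -j_e ?lamC // lev_shift.
Qed.
End Linearization.

(** * Multiples of the minimal leaders *)

Section MultiplesOfLowLeaders.
Variables (m n r : nat) (lead : vindex m n -> Prop).
Local Notation I := (vindex m n).
Implicit Types (v w u : I) (i j l : 'I_m).
Hypothesis lead_up : forall v i, lead v -> (lev v < r.*2.+1)%N -> lead (shift v i).
Hypothesis lead_min : forall v, lead v -> (r < lev v <= r.*2.+1)%N ->
  exists i, (0 < v.1 i)%N /\ lead (unshift v i).

(** Leaders are controlled only up to level [2r + 1]; the multiples of those of level at most [r]
    continue them to all levels. *)
Definition low_multiple v : bool :=
  asb (exists p, [/\ lead p, (lev p <= r)%N & vle p v]).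

Lemma vle_refl v : vle v v.
Proof. by rewrite /vle eqxx; apply/forallP. Qed.

Lemma vle_shift p v i : vle p v -> vle p (shift v i).
Proof.
move=> /andP [h1 /forallP h2]; rewrite /vle h1; apply/forallP => j; rewrite ffunE.
exact: leq_trans (h2 j) (leq_addr _ _).
Qed.

Lemma low_multiple_up v i : low_multiple v -> low_multiple (shift v i).
Proof. by move=> /asbP [p [h1 h2 /(vle_shift i) h3]]; apply/asbP; exists p. Qed.

(** As no minimal leader has a level from [r + 1] to [2r + 1], each leader there can be lowered
    until its level is at most [r]. *)
Lemma low_multipleP v : (lev v <= r.*2.+1)%N -> low_multiple v <-> lead v.
Proof.
move=> lv; split=> [/asbP [p [lp _ pv]]|]; first exact: upward_closed pv lv.
have [k] := ubnP (lev v); elim: k v lv => // k IH v lv vk Lv.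
have [lr|lr] := leqP (lev v) r; first by apply/asbP; exists v; split=> //; exact: vle_refl.
have [|i [v0 Li]] := lead_min Lv; first by rewrite lr.
rewrite -(unshiftK v0); have e := lev_unshift v0; apply: low_multiple_up; apply: IH => //.
  by apply: ltnW; rewrite -e.
by rewrite -ltnS -e.
Qed.

Lemma low_multiple_down v : low_multiple v -> (r < lev v)%N ->
  exists w i, v = shift w i /\ low_multiple w.
Proof.
move=> /asbP [p [lp pr pv]] lv.
have [|i hi] := vle_proper pv; first by apply: contraTneq lv => <-; rewrite -leqNgt.
exists (unshift v i), i; split; first by rewrite unshiftK //; exact: leq_ltn_trans hi.
by apply/asbP; exists p; split=> //; exact: vle_unshift.
Qed.

Lemma shift_neq v i l : l != i -> (shift v i).1 l = v.1 l.
Proof. by rewrite ffunE => /negPf ->; rewrite addn0. Qed.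

(* Two minimal leaders of level at most [r] have a common multiple of level at most [2r], so
   beyond that level some coordinate exceeds both. *)
Lemma low_multiple_connect v w i j : shift v i = shift w j -> i != j ->
  low_multiple v -> low_multiple w -> (r.*2 < lev v)%N ->
  (exists u, [/\ low_multiple u, v = shift u j & w = shift u i]) \/
  exists l u u', [/\ low_multiple u, low_multiple u', v = shift u l, w = shift u' l
                   & shift u i = shift u' j].
Proof.
move=> e ij /asbP [p [lp pr pv]] /asbP [q [lq qr qw]] lv.
have low x y l : lead x -> (lev x <= r)%N -> vle x y -> (x.1 l < y.1 l)%N ->
    low_multiple (unshift y l) /\ y = shift (unshift y l) l.
  move=> h1 h2 h3 h4; split; last by rewrite unshiftK //; exact: leq_ltn_trans h4.
  by apply/asbP; exists x; split=> //; exact: vle_unshift.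
pose z := shift v i.
have [l [pl ql]] : exists l, (p.1 l < z.1 l)%N /\ (q.1 l < z.1 l)%N.
  have [l /andP [h1 h2]|no] := pickP (fun l => (p.1 l < z.1 l)%N && (q.1 l < z.1 l)%N).
    by exists l.
  have : (lev z <= lev p + lev q)%N.
    rewrite /lev /mabs -big_split /=; apply: leq_sum => l _.
    have := no l; rewrite /= => /negbT; rewrite negb_and -!leqNgt => /orP [h|h].
      exact: leq_trans h (leq_addr _ _).
    exact: leq_trans h (leq_addl _ _).
  move=> h; have := leq_trans h (leq_add pr qr); rewrite addnn lev_shift.
  by move=> h'; have := leq_trans lv (ltnW h'); rewrite ltnn.
(* If [l] is [i] or [j], lowering one of [v], [w] gives a common predecessor; otherwise both are
   lowered in the direction [l]. *)
have [li|li] := eqVneq l i.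
  left; move: ql; rewrite li /z e shift_neq // => /(low _ _ _ lq qr qw) [h1 h2].
  exists (unshift w i); split=> //; apply: (@shift_inj _ _ i).
  by rewrite shiftC -h2.
have [lj|lj] := eqVneq l j.
  left; move: pl; rewrite lj /z shift_neq 1?eq_sym // => /(low _ _ _ lp pr pv) [h1 h2].
  exists (unshift v j); split=> //; apply: (@shift_inj _ _ j).
  by rewrite shiftC -h2.
right; exists l, (unshift v l), (unshift w l).
have [h1 h2] : low_multiple (unshift v l) /\ v = shift (unshift v l) l.
  by apply: (low p) => //; move: pl; rewrite /z shift_neq.
have [h3 h4] : low_multiple (unshift w l) /\ w = shift (unshift w l) l.
  by apply: (low q) => //; move: ql; rewrite /z e shift_neq.
split=> //; apply: (@shift_inj _ _ l).
by rewrite shiftC -h2 e shiftC -h4.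
Qed.
End MultiplesOfLowLeaders.

(** * Construction of the compatible extension *)

Lemma subfield_lift (K F L : fieldType) (j : {rmorphism F -> L}) (iota : {rmorphism K -> L}) :
  (forall k, exists y, j y = iota k) -> exists kF : {rmorphism K -> F}, forall k, j (kF k) = iota k.
Proof.
move=> /choose_fun [f hf].
have fB : zmod_morphism f by move=> x y; apply: (fmorph_inj j); rewrite rmorphB !hf rmorphB.
have fM : monoid_morphism f.
  by split=> [|x y]; apply: (fmorph_inj j); rewrite ?rmorph1 ?rmorphM !hf ?rmorph1 ?rmorphM.
pose kF : {rmorphism K -> F} :=
  HB.pack f (GRing.isZmodMorphism.Build _ _ f fB) (GRing.isMonoidMorphism.Build _ _ f fM).
by exists kF.
Qed.

Theorem theorem4p10 (m : nat) (hm : (0 < m)%N) (K : fieldType) (d : 'I_m -> K -> K)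
  (hd : commuting_derivations d) (r n : nat) (hr : (0 < r)%N) (hn : (0 < n)%N) :
  exists s : nat, (r <= s)%N /\
    forall (L : fieldType) (iota : {rmorphism K -> L}) (a : mindex m -> nat -> L),
      differential_condition n s d iota a ->
      exists (M : fieldType) (D : 'I_m -> M -> M) (phi : {rmorphism K -> M}) (f : L -> M),
        [/\ commuting_derivations D,
            (forall (i : 'I_m) (c : K), D i (phi c) = phi (d i c)),
            gen_field_embedding n r iota phi a f &
            (forall (i : 'I_m) (k : nat) (sigma : mindex m),
               (k < n)%N -> (mabs sigma + 1 <= r)%N ->
               D i (f (a sigma k)) = f (a (madd_eps sigma i) k))].
Proof.
(* The bound depends on [m], [n] and [r] alone. It is positive as [r] is, and has the form [s.+1]
   because the derivations are obtained up to level [s]. *)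
have [[|s] [rs hs]] := no_new_minimal m n r; first by move: hr; rewrite ltnNge rs.
exists s.+1; split=> // L iota a dc.
pose av := @var_value m n L a.
have [D hD] := choose_fun (differential_condition_derivation hm hn (proj1 hd) dc).
have lead_up v i : leader iota av v -> (lev v < s.+1)%N -> leader iota av (shift v i).
  move=> Lv lv; apply: rational_leader; apply: (leader_shift (d := d) (D := D)) Lv lv => l;
  by case: (hD l).
have [r' [rr' r's lead_min]] := hs _ lead_up.
(* With this [t], level [t + 1] is the last one of the interval without minimal leaders. *)
pose t := r'.*2; have ts : (t <= s)%N by [].
have rt : (r <= t)%N by apply: leq_trans rr' _; rewrite /t -addnn leq_addr.
pose G := genf iota av (fun v => lev v <= t)%N.
have GB x y : G x -> G y -> G (x - y) by move=> hx hy; apply: genfD => //; exact: genfN.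
have Gdiv x y : G x -> G y -> G (x / y) by move=> hx hy; apply: genfM => //; exact: genfV.
have [F [j j_onto]] := exists_subfield (genf1 iota av _ : G 1) GB Gdiv.
have [E [c [b [free rigid]]]] := FreePolynomials.rational_functions F (vindex m n).
have [|kF j_kF] := @subfield_lift K F L j iota.
  by move=> k; apply/j_onto; exact: genf_const.
have [|e j_e] := @choose_fun (vindex m n) F (fun v y => (lev v <= t)%N -> j y = av v).
  move=> v; have [lv|_] := leqP (lev v) t; last by exists 0.
  by have /j_onto [y <-] : G (av v) by [exact: genf_var]; exists y.
have lead_up' v i : leader iota av v -> (lev v < t.+1)%N -> leader iota av (shift v i).
  by move=> Lv lv; apply: lead_up => //; exact: leq_trans lv _.
have subG x : G x -> genf iota av (fun v => lev v <= s)%N x.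
  by apply: genf_sub => v /leq_trans; apply.
have [v Lv lv|v lv|v i|v Lv lv|v w i l evw il Lv Lw lv|D' [D'comm D'K D'e]] :=
  @extend_derivations m n K L iota av t d D
  (fun i x y hx hy => let: And3 h _ _ := hD i in h x y (subG x hx) (subG y hy))
  (fun i => let: And3 _ h _ := hD i in h)
  (fun i v lv => let: And3 _ _ h := hD i in h v (leq_trans lv ts))
  F E j c b j_onto _ kF e j_kF j_e (low_multiple r' (leader iota av)) _ (proj2 hd)
  free rigid _ _ _.
- have [|i [v0 Lw]] := lead_min v Lv; first by rewrite lv leqnn andbT ltnS /t -addnn leq_addr.
  by exists (unshift v i), i; rewrite unshiftK.
- exact: low_multipleP.
- exact: low_multiple_up.
- by apply: low_multiple_down => //; apply: leq_ltn_trans lv; rewrite /t -addnn leq_addr.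
- exact: low_multiple_connect evw il Lv Lw lv.
pose phi : {rmorphism K -> E} := c \o kF.
(* [f] is the inverse of [j] followed by [c]; outside the image of [j] it is 0 by default. *)
have [x|f hf] := @choose_fun L E (fun x y => forall z, j z = x -> y = c z).
  have [[z <-]|no] := classic (exists z, j z = x); last by exists 0 => z ez; case: no; exists z.
  by exists (c z) => z' /fmorph_inj ->.
have fj z : f (j z) = c z by exact: hf.
have f_in x : in_gen_field n r iota a x -> exists z, x = j z.
  move=> /in_gen_field_genf hx; have /j_onto [z <-] : G x; last by exists z.
  by apply: genf_sub hx => v /leq_trans; apply.
exists E, D', phi, f; split=> //.
  split=> [k|x y /f_in [x' ->] /f_in [y' ->]]; first by rewrite -j_kF fj.
  by rewrite -rmorphD -rmorphM !fj rmorphD rmorphM.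
move=> i k sigma kn; rewrite addn1 => lr.
pose v : vindex m n := (sigma, Ordinal kn).
have lv : (lev v < t)%N by exact: leq_trans rt.
have -> : a sigma k = j (e v) by rewrite j_e // ltnW.
have -> : a (madd_eps sigma i) k = j (e (shift v i)) by rewrite j_e // lev_shift.
by rewrite !fj D'e.
Qed.
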